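(* Let $u(x)$ be a Gaussian random function with law $\mu_0$, mean $\langle u(x)\rangle$ and covariance $\mathrm{Cov}[u(x),u(y)]=a^{-1}(x,y)$. Let $g_1,\dots,g_N$ be kernels, let $U_\alpha[u(\cdot)]=\int g_\alpha(x)u(x)\,dx$ for $\alpha=1,\dots,N$, and let $M$ be the $N\times N$ matrix, assumed invertible, with entries $$m_{\beta\alpha}=\mathrm{Cov}\big[U_\beta[u(\cdot)],U_\alpha[u(\cdot)]\big]=\iint g_\beta(x)\,a^{-1}(x,y)\,g_\alpha(y)\,dx\,dy .$$ Denote the entries of $M^{-1}$ by $m^{-1}_{\beta\alpha}$, and let $$c_\alpha(x)=\sum_{\beta=1}^N\Big(\int a^{-1}(x,y)\,g_\beta(y)\,dy\Big)\,m^{-1}_{\beta\alpha}.$$ Then for every $V=(V_1,\dots,V_N)^T\in\mathbb{R}^N$, the conditional covariance of $u$ given $U_\alpha[u(\cdot)]=V_\alpha$, $\alpha=1,\dots,N$, differs from the unconditional covariance by a function that depends on the kernels $g_\alpha$ but not on the conditioning data $V$: $$\mathrm{Cov}[u(x),u(y)]_V=\mathrm{Cov}[u(x),u(y)]-\sum_{\alpha=1}^N c_\alpha(x)\int g_\alpha(z)\,a^{-1}(z,y)\,dz .$$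
   Context: A random real-valued function $u(x)$ is Gaussian with law $\mu_0$ if it has (formal) probability density $$f_0[u(\cdot)]=Z^{-1}\exp\Big(-\tfrac12\iint u(x)a(x,y)u(y)\,dx\,dy+\int b(x)u(x)\,dx\Big),$$ with $a(x,y)$, $b(x)$ (generalized) functions and $Z$ a normalizing constant. Averages with respect to $\mu_0$ are denoted $\langle\cdot\rangle$. The mean and covariance are $\langle u(x)\rangle=\int a^{-1}(x,y)b(y)\,dy$ and $$\mathrm{Cov}[u(x),u(y)]=\langle u(x)u(y)\rangle-\langle u(x)\rangle\langle u(y)\rangle=a^{-1}(x,y),$$ where $a^{-1}$ is the integral-kernel inverse of $a$, defined by $\int a(x,z)a^{-1}(z,y)\,dz=\int a^{-1}(x,z)a(z,y)\,dz=\delta(x-y)$. The kernels $g_\alpha$ are (generalized) functions such that the integrals written are meaningful. The linear functionals $U_\alpha[u(\cdot)]=\int g_\alpha(x)u(x)\,dx$ (called collective variables) are then jointly Gaussian together with the values $u(x)$, and $\mathrm{Cov}[u(x),U_\alpha]=\int a^{-1}(x,y)g_\alpha(y)\,dy$. For $V\in\mathbb{R}^N$, the conditional measure $\mu_V$ is the prior conditioned on $U_\alpha[u(\cdot)]=V_\alpha$ for all $\alpha$. Formally it has density $f_V[u(\cdot)]=c\,f_0[u(\cdot)]\prod_{\alpha=1}^N\delta(U_\alpha[u(\cdot)]-V_\alpha)$ with $c$ a normalization factor. Averages with respect to $\mu_V$ are denoted $\langle\cdot\rangle_V$; equivalently, $\langle O\rangle_V$ is the value at $V$ of the version, continuous in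 $V$, of the conditional expectation of $O[u(\cdot)]$ given $(U_1,\dots,U_N)=V$. The conditional covariance is $\mathrm{Cov}[u(x),u(y)]_V=\langle u(x)u(y)\rangle_V-\langle u(x)\rangle_V\langle u(y)\rangle_V$. *)

(* Defs.v *)
From mathcomp Require Import all_boot all_order all_algebra.
From mathcomp Require Import all_classical all_reals all_analysis.

Set Implicit Arguments.
Unset Strict Implicit.
Unset Printing Implicit Defensive.

Import Order.TTheory GRing.Theory Num.Theory.
Import numFieldNormedType.Exports.

Local Open Scope classical_set_scope.
Local Open Scope ring_scope.

(* A generalized function g on X: [pairing g f] is the integral of g(x)f(x)dx,
   which is meaningful only when f belongs to the linear space [pdom g]; outside
   [pdom g] the value of [pairing g] is junk. *)
Record gen_fun (X : Type) (R : realType) := GenFun {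
  pdom : set (X -> R);
  pairing : (X -> R) -> R;
  pdom0 : pdom (fun=> 0);
  pdomP : forall c f h, pdom f -> pdom h -> pdom (fun x => c * f x + h x);
  pairingP : forall c f h, pdom f -> pdom h ->
    pairing (fun x => c * f x + h x) = c * pairing f + pairing h }.

(* The two basic examples: an ordinary function k, for which the pairing is the
   Lebesgue integral of k f, and the Dirac function at a point. *)
Section gen_fun_examples.
Context (d : measure_display) (X : measurableType d) (R : realType).
Variable mu : {measure set X -> \bar R}.
Variable k : X -> R.

Let dom : set (X -> R) :=
  [set f | mu.-integrable setT (EFin \o (fun x => k x * f x))].
Let itg (f : X -> R) : R := (\int[mu]_x (k x * f x))%R.

Let dom0 : dom (fun=> 0).
Proof.
rewrite /dom/=; have -> : EFin \o (fun x => k x * 0) = cst 0%E.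
  by apply/funext => x /=; rewrite mulr0.
exact: integrable0.
Qed.

Let combE c f h : EFin \o (fun x => k x * (c * f x + h x)) =
  ((fun x => c%:E * (k x * f x)%:E) \+ (EFin \o (fun x => (k x * h x)%R)))%E.
Proof. by apply/funext => x /=; rewrite -EFinM -EFinD mulrDr mulrCA. Qed.

Let domP c f h : dom f -> dom h -> dom (fun x => c * f x + h x).
Proof.
rewrite /dom/= => df dh; rewrite combE; apply: integrableD => //.
exact: integrableZl.
Qed.

Let intP c f h : dom f -> dom h ->
  itg (fun x => c * f x + h x) = c * itg f + itg h.
Proof.
rewrite /dom/= => df dh; rewrite /itg.
under eq_Rintegral do rewrite mulrDr mulrCA.
rewrite RintegralD//; first by rewrite RintegralZl.
exact: (integrableZl _ c df).
Qed.

Definition gen_fun_of_fun : gen_fun X R := GenFun dom0 domP intP.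

End gen_fun_examples.

Definition gen_fun_dirac (X : Type) (R : realType) (x0 : X) : gen_fun X R :=
  @GenFun X R setT (fun f => f x0) I (fun _ _ _ _ _ => I)
    (fun _ _ _ _ _ => erefl).

Section gaussian.
Context (d : measure_display) (T : measurableType d) (R : realType).
Variable P : probability T R.

(* Point masses are Gaussian; they are treated apart because the library's
   [normal_prob m 0] is not [\d_m]. *)
Definition gaussian (Y : T -> R) : Prop :=
  exists m s : R, forall B : set R, measurable B ->
    pushforward P Y B = if s == 0 then \d_m B else normal_prob m s B.

Definition jointly_gaussian (I : Type) (Y : I -> {RV P >-> R}) : Prop :=
  forall (n : nat) (i : 'I_n -> I) (c : 'I_n -> R),
    gaussian (fun w => \sum_(k < n) c k * Y (i k) w).

Definition family_sum (I J : Type) (Y : I -> {RV P >-> R})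
    (Z : J -> {RV P >-> R}) (k : I + J) : {RV P >-> R} :=
  match k with inl i => Y i | inr j => Z j end.

End gaussian.

Section conditioning.
Context (d : measure_display) (T : measurableType d) (R : realType).
Variable P : probability T R.
Variables (N : nat) (U : 'I_N -> {RV P >-> R}).

(* phi(U) is a version of the conditional expectation of O given the
   sigma-algebra generated by U_1, ..., U_N, and phi is continuous. *)
Definition is_cond_mean (O : T -> R) (phi : 'cV[R]_N -> R) : Prop :=
  let phiU w := phi (\col_a U a w) in
  [/\ continuous phi,
      P.-integrable setT (EFin \o O),
      P.-integrable setT (EFin \o phiU) &
      forall E : set T, g_sigma_preimage U E ->
        (\int[P]_(w in E) (O w)%:E = \int[P]_(w in E) (phiU w)%:E)%E].

Definition cond_mean_exists (O : T -> R) : Prop :=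
  exists! phi : 'cV[R]_N -> R, is_cond_mean O phi.

(* Meaningful under [cond_mean_exists O]. *)
Definition cond_mean (O : T -> R) (V : 'cV[R]_N) : R :=
  xget (fun=> 0) [set phi | is_cond_mean O phi] V.

Definition cond_cov (Y Z : T -> R) (V : 'cV[R]_N) : R :=
  cond_mean (fun w => Y w * Z w) V - cond_mean Y V * cond_mean Z V.

End conditioning.

Definition regression_coef (R : realType) (X : Type) (N : nat)
    (ainv : X -> X -> R) (g : 'I_N -> gen_fun X R) (M : 'M[R]_N)
    (a : 'I_N) (x : X) : R :=
  \sum_(b < N) pairing (g b) (fun y => ainv x y) * (invmx M) b a.

(* Main.v *)
(* Write u(x) = E u(x) + c(x).(U - E U) + xi(x). The coefficients c(x) make the centred variable
   xi(x) uncorrelated with every U_a, and in a Gaussian space uncorrelated means independent. Hence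
   <u(x)>_V is affine in V, <u(x)u(y)>_V = <u(x)>_V <u(y)>_V + E[xi(x) xi(y)], and the last term
   does not see V.

   Independence is obtained from Fourier transforms; the characteristic function of a normal law
   follows from Stein's identity. A signed measure psi dP whose image under Z has zero Fourier
   transform vanishes on sigma(Z): trigonometric polynomials reproduce the sign of sin((W - a)/n),
   hence the sign of W - a, hence half-lines, one coordinate W of Z at a time.

   Conditional means are unique among continuous functions because U charges every open set: M is
   invertible, so U can be translated in any direction along an independent Gaussian coordinate. *)

Require Import Defs.
From mathcomp Require Import all_boot all_order all_algebra.
From mathcomp Require Import all_classical all_reals all_analysis.
From mathcomp Require Import measurable_realfun.
From mathcomp Require Import ring lra.

Set Implicit Arguments.
Unset Strict Implicit.
Unset Printing Implicit Defensive.

Import Order.TTheory GRing.Theory Num.Theory.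
Import numFieldNormedType.Exports.

Local Open Scope classical_set_scope.
Local Open Scope ring_scope.

(** * Integration of real-valued functions *)

Section integral_tools.
Context (d : measure_display) (T : measurableType d) (R : realType).
Variable mu : {measure set T -> \bar R}.

(** Degenerate variables must be allowed: xi(x) vanishes when u(x) is an affine function of U. No
    joint density is therefore available, and conditioning cannot be done by dividing densities.
    Densities occur only for one-dimensional laws; afterwards everything rests on characteristic
    functions and second moments. The Fourier argument is real. Its test functions are cosines with
    an arbitrary phase, so that the phase supplies the sine and product-to-sum formulas replace
    products of exponentials. It concerns a signed density psi because it is applied to centred
    indicators, to xi(x), to xi(x) times a combination of the centred U_a, and to xi(x)xi(y) minus
    its mean. The last three are unbounded. They are reached by replacing a factor f with n
    sin(f/n), which tends to f and is dominated by |f|. Polarization reduces xi(x)xi(y) to squares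
    of single variables, so the pair is never treated as a vector. A conditional mean is a value at
    each V, not an almost sure class; this is why full support is required. *)

Lemma integrable_mul_bounded (f g : T -> R) (C : R) :
  mu.-integrable setT (EFin \o f) -> measurable_fun setT g ->
  (forall w, `|g w| <= C) ->
  mu.-integrable setT (EFin \o (fun w => f w * g w)).
Proof.
move=> fi mg gC.
have mf : measurable_fun setT f by apply/measurable_EFinP; case/integrableP: fi.
apply: (le_integrable measurableT _ _ (integrableZl measurableT `|C| fi)).
  by apply/measurable_EFinP; exact: measurable_funM.
move=> w _ /=; rewrite lee_fin !normrM normr_id mulrC ler_wpM2r//.
by rewrite (le_trans (gC w))// ler_norm.
Qed.

Lemma dominated_Rcvg (f_ : nat -> T -> R) (f G : T -> R) :
  (forall n, measurable_fun setT (f_ n)) ->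
  (forall w, f_ n w @[n --> \oo] --> f w) ->
  mu.-integrable setT (EFin \o G) -> (forall n w, `|f_ n w| <= G w) ->
  (\int[mu]_w f_ n w)%R @[n --> \oo] --> (\int[mu]_w f w)%R.
Proof.
move=> mf_ cf iG fG.
have mf : measurable_fun setT f.
  by apply: (measurable_fun_cvg mf_) => w _; exact: cf.
have mE (g : T -> R) : measurable_fun setT g -> measurable_fun setT (EFin \o g).
  by move=> mg; exact/measurable_EFinP.
have fi : mu.-integrable setT (EFin \o f).
  apply: (le_integrable measurableT _ _ iG); first exact: mE.
  move=> w _; have G0 : 0 <= G w by exact: le_trans (normr_ge0 _) (fG 0%N w).
  rewrite lee_fin /= [leRHS]ger0_norm//.
  have h : `|f_ n w| @[n --> \oo] --> `|f w| by apply: cvg_norm; exact: cf.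
  rewrite -(cvg_lim _ h)//.
  apply: limr_le; first by apply/cvg_ex; exists `|f w|.
  apply: nearW => n; exact: fG.
apply: fine_cvg; rewrite fineK; last exact: integrable_fin_num.
apply: (@dominated_cvg _ _ _ _ _ measurableT _ _ (EFin \o G)) => //.
- by move=> n; exact: mE.
- by move=> w _; apply: cvg_EFin; [exact: nearW|exact: cf].
- by move=> n w _; rewrite lee_fin; exact: fG.
Qed.

End integral_tools.

(** * Fourier transforms of signed measures *)

Section sign_approximation.
Context (R : realType).
Implicit Types (t x y : R) (m n : nat).

Lemma bernoulli_ineq t m : -1 <= t -> 1 + m%:R * t <= (1 + t) ^+ m.
Proof.
move=> t1; elim: m => [|m IH]; first by rewrite mul0r addr0 expr0.
have t0 : 0 <= 1 + t by lra.
rewrite exprS (le_trans _ (ler_wpM2l t0 IH))// -natr1.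
have : 0 <= m%:R * (t * t) by rewrite mulr_ge0// -expr2 sqr_ge0.
lra.
Qed.

(** The polynomials (1 - x^n)^(2^n) are the approximate step functions of the Brosowski-Deutsch
    proof of the Stone-Weierstrass theorem, with threshold 1/2. Below it, Bernoulli gives the lower
    bound 1 - (2x)^n. *)
Lemma cvg_step_lt x : 0 <= x -> x < 2^-1 ->
  (1 - x ^+ n) ^+ (2 ^ n) @[n --> \oo] --> (1 : R).
Proof.
move=> x0 x1.
apply: (@squeeze_cvgr _ _ _ _ (fun n => 1 - (2 * x) ^+ n) (cst 1)); last 2 first.
- rewrite -[X in _ --> X]subr0; apply: cvgB; first exact: cvg_cst.
  apply: cvg_expr; rewrite ger0_norm; lra.
- exact: cvg_cst.
apply: nearW => n /=.
have xn : 0 <= x ^+ n <= 1 by rewrite exprn_ge0//= exprn_ile1//; lra.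
apply/andP; split; last by rewrite exprn_ile1//; lra.
have : -1 <= - x ^+ n by lra.
move/(@bernoulli_ineq _ (2 ^ n)); rewrite natrX exprMn; lra.
Qed.

(** Multiplying by (1 + x^n)^(2^n), which is at least (2x)^n by Bernoulli, gives (1 - x^(2n))^(2^n)
    <= 1; hence the bound (2x)^(-n). *)
Lemma cvg_step_gt x : 2^-1 < x -> x <= 1 ->
  (1 - x ^+ n) ^+ (2 ^ n) @[n --> \oo] --> (0 : R).
Proof.
move=> x0 x1; have x20 : 0 < 2 * x by lra.
apply: (@squeeze_cvgr _ _ _ _ (cst 0) (fun n => (2 * x)^-1 ^+ n)); last 2 first.
- exact: cvg_cst.
- apply: cvg_expr; rewrite ger0_norm ?invr_ge0; last lra.
  by rewrite invf_lt1//; lra.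
apply: nearW => n /=.
have xn : 0 <= x ^+ n <= 1 by rewrite exprn_ge0 ?exprn_ile1//; lra.
have s0 : 0 <= (1 - x ^+ n) ^+ (2 ^ n) by rewrite exprn_ge0//; lra.
rewrite s0/= exprVn -[leRHS]mul1r ler_pdivlMr ?exprn_gt0//.
have h1 : -1 <= x ^+ n by lra.
have := @bernoulli_ineq _ (2 ^ n) h1; rewrite natrX -exprMn => h2.
apply: (@le_trans _ _ ((1 - x ^+ n) ^+ (2 ^ n) * (1 + x ^+ n) ^+ (2 ^ n))).
  by rewrite ler_wpM2l//; lra.
rewrite -exprMn; apply: exprn_ile1.
  by rewrite mulr_ge0//; lra.
have : 0 <= x ^+ n * x ^+ n by rewrite mulr_ge0//; lra.
lra.
Qed.

(** The two mirrored steps cancel exactly at y = 0, so their behaviour at the threshold never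
    matters. The approximants are polynomials in y, ready for y = sin. *)
Lemma cvg_sgr_approx y : `|y| <= 1 ->
  (1 - ((1 - y) / 2) ^+ n) ^+ (2 ^ n) - (1 - ((1 + y) / 2) ^+ n) ^+ (2 ^ n)
    @[n --> \oo] --> Num.sg y.
Proof.
rewrite ler_norml => /andP[y1 y2].
have [y0|y0|<-] := ltgtP 0 y; last 1 first.
- rewrite sgr0 subr0 addr0 -(subrr (0:R)).
  under eq_fun do rewrite subrr -(subrr (0 : R)).
  exact: cvg_cst.
- rewrite gtr0_sg// -[X in _ --> X]subr0.
  by apply: cvgB; [apply: cvg_step_lt|apply: cvg_step_gt]; lra.
- rewrite ltr0_sg// -[X in _ --> X]sub0r.
  by apply: cvgB; [apply: cvg_step_gt|apply: cvg_step_lt]; lra.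
Qed.

End sign_approximation.

Section trig_annihilator.
Context (d : measure_display) (T : measurableType d) (R : realType).
Variable (mu : {measure set T -> \bar R}) (W : T -> R).
Hypothesis mW : measurable_fun setT W.

(* The image under W of the signed measure psi dmu has zero Fourier transform. *)
Definition trig_null (psi : T -> R) : Prop :=
  mu.-integrable setT (EFin \o psi) /\
  forall s b, \int[mu]_w (psi w * cos (s * W w + b)) = 0.

Lemma measurable_sin_affine t c : measurable_fun setT (fun w => sin (t * W w + c)).
Proof.
apply: measurableT_comp; first by apply: continuous_measurable_fun; exact: continuous_sin.
by apply: measurable_funD => //; apply: measurable_funM.
Qed.

Lemma measurable_cos_affine t c : measurable_fun setT (fun w => cos (t * W w + c)).
Proof.
apply: measurableT_comp; first by apply: continuous_measurable_fun; exact: continuous_cos.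
by apply: measurable_funD => //; apply: measurable_funM.
Qed.

Lemma integrable_mul_cos psi s b : mu.-integrable setT (EFin \o psi) ->
  mu.-integrable setT (EFin \o (fun w => psi w * cos (s * W w + b))).
Proof.
move=> ipsi; apply: integrable_mul_bounded ipsi (measurable_cos_affine s b) _.
by move=> w; exact: cos_max.
Qed.

Lemma trig_null_integral psi : trig_null psi -> \int[mu]_w psi w = 0.
Proof.
move=> [_ /(_ 0 0)] => <-; apply: eq_Rintegral => w _.
by rewrite mul0r addr0 cos0 mulr1.
Qed.

Lemma trig_null_lin a b psi phi : trig_null psi -> trig_null phi ->
  trig_null (fun w => a * psi w + b * phi w).
Proof.
move=> [ipsi npsi] [iphi nphi]; split.
  have := integrableD measurableT (integrableZl measurableT a ipsi)
    (integrableZl measurableT b iphi).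
  by apply: eq_integrable.
move=> s c.
under eq_Rintegral do rewrite mulrDl -!mulrA.
rewrite RintegralD//.
- rewrite !RintegralZl// ?npsi ?nphi ?mulr0 ?addr0//; exact: integrable_mul_cos.
- exact: (integrableZl _ a (integrable_mul_cos s c ipsi)).
- exact: (integrableZl _ b (integrable_mul_cos s c iphi)).
Qed.

(** Product-to-sum: sin times cos is a combination of cosines of frequencies s + t and s - t with
    phases moved by pi/2, all annihilated by psi. *)
Lemma trig_null_sin t c psi : trig_null psi ->
  trig_null (fun w => psi w * sin (t * W w + c)).
Proof.
move=> [ipsi npsi]; split.
  apply: integrable_mul_bounded ipsi (measurable_sin_affine t c) _.
  by move=> w; exact: sin_max.
move=> s b.
have -> : \int[mu]_w (psi w * sin (t * W w + c) * cos (s * W w + b)) =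
   \int[mu]_w (2^-1 * (psi w * cos ((s + t) * W w + (b + c - pi / 2))) +
             2^-1 * (psi w * cos ((s - t) * W w + (b - c + pi / 2)))).
  apply: eq_Rintegral => w _.
  rewrite (_ : (s + t) * W w + _ = s * W w + b + (t * W w + c) - pi / 2); last by field.
  rewrite (_ : (s - t) * W w + _ = s * W w + b - (t * W w + c) + pi / 2); last by field.
  by rewrite cosBpihalf cosDpihalf (sinD (s * W w + b)) (sinB (s * W w + b)); field.
rewrite RintegralD//.
- rewrite !RintegralZl// ?npsi ?mulr0 ?addr0//; exact: integrable_mul_cos.
- exact: (integrableZl _ _ (integrable_mul_cos _ _ ipsi)).
- exact: (integrableZl _ _ (integrable_mul_cos _ _ ipsi)).
Qed.

(** Annihilation survives multiplication by any polynomial in sin(tW + c). The parameter [e] is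
    meant to be 1 or -1 and selects one of the two mirrored steps. *)
Lemma trig_null_step (e : R) n m t c psi : trig_null psi ->
  trig_null (fun w => psi w * (1 - ((1 + e * sin (t * W w + c)) / 2) ^+ n) ^+ m).
Proof.
move=> npsi.
have nX k phi : trig_null phi ->
    trig_null (fun w => phi w * ((1 + e * sin (t * W w + c)) / 2) ^+ k).
  move=> nphi; elim: k => [|k IH].
    by under eq_fun do rewrite expr0 mulr1.
  have := trig_null_lin (2^-1) (e / 2) IH (trig_null_sin t c IH).
by congr trig_null; apply/funext => w; rewrite exprS; field.
elim: m => [|m IH]; first by under eq_fun do rewrite expr0 mulr1.
have := trig_null_lin 1 (-1) IH (nX n _ IH).
by congr trig_null; apply/funext => w; rewrite exprS; field.
Qed.

End trig_annihilator.

Section trig_uniqueness.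
Context (d : measure_display) (T : measurableType d) (R : realType).
Variable mu : {measure set T -> \bar R}.

Lemma measurable_sgr : measurable_fun setT (@Num.sg R).
Proof.
apply: nondecreasing_measurable => // x y xy.
have [x0|x0|x0] := ltgtP 0 x; have [y0|y0|y0] := ltgtP 0 y;
  rewrite -?x0 -?y0 ?sgr0 ?(gtr0_sg x0) ?(gtr0_sg y0) ?(ltr0_sg x0) ?(ltr0_sg y0); lra.
Qed.

Lemma trig_null_sg (W : T -> R) t c psi : measurable_fun setT W ->
  trig_null mu W psi -> \int[mu]_w (psi w * Num.sg (sin (t * W w + c))) = 0.
Proof.
move=> mW npsi.
have mS := measurable_sin_affine mW t c.
have mpsi : measurable_fun setT psi.
  by apply/measurable_EFinP; case/integrableP: npsi.1.
(* Both steps take values in [0, 1], so their difference is bounded by 1 and |psi| dominates. *)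
pose F (e : R) n w := (1 - ((1 + e * sin (t * W w + c)) / 2) ^+ n) ^+ (2 ^ n).
have F01 e n w : `|e| <= 1 -> 0 <= F e n w <= 1.
  rewrite ler_norml => e1; have := sin_max (t * W w + c).
  rewrite /F; set s := sin _; rewrite ler_norml => s1.
  have es : -1 <= e * s <= 1.
    by rewrite -ler_norml normrM mulr_ile1// ler_norml.
  have x01 : 0 <= ((1 + e * s) / 2) ^+ n <= 1.
    by rewrite exprn_ge0 ?exprn_ile1//; lra.
  by rewrite exprn_ge0 ?exprn_ile1//; lra.
have : \int[mu]_w (psi w * (F (-1) n w - F 1 n w)) @[n --> \oo] -->
    \int[mu]_w (psi w * Num.sg (sin (t * W w + c))).
  apply: (@dominated_Rcvg _ _ _ _ _ _ (fun w => `|psi w|)).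
  - move=> n; apply: measurable_funM => //; apply: measurable_funB.
    + apply: measurable_funX; apply: measurable_funB => //.
      apply: measurable_funX; apply: measurable_funM => //.
      by apply: measurable_funD => //; apply: measurable_funM.
    + apply: measurable_funX; apply: measurable_funB => //.
      apply: measurable_funX; apply: measurable_funM => //.
      by apply: measurable_funD => //; apply: measurable_funM.
  - move=> w; apply: cvgM; first exact: cvg_cst.
    rewrite /F; under eq_fun do rewrite mul1r mulN1r.
    exact/cvg_sgr_approx/sin_max.
  - exact: integrable_norm npsi.1.
  - move=> n w; rewrite normrM ler_piMr//.
    have := F01 (-1) n w; have := F01 1 n w.
    rewrite normrN normr1 ler_norml => /(_ (lexx _)) ? /(_ (lexx _)) ?; lra.
have -> : (fun n => \int[mu]_w (psi w * (F (-1) n w - F 1 n w))) = cst 0.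
  apply/funext => n.
  have := trig_null_lin mW 1 (-1)
    (trig_null_step mW (-1) n (2 ^ n) t c npsi)
    (trig_null_step mW 1 n (2 ^ n) t c npsi).
  move/trig_null_integral => <-; apply: eq_Rintegral => w _; rewrite /F; ring.
move/cvg_lim => <-//; exact: lim_cst.
Qed.

Lemma trig_null_sgB (W : T -> R) a psi : measurable_fun setT W ->
  trig_null mu W psi -> \int[mu]_w (psi w * Num.sg (W w - a)) = 0.
Proof.
move=> mW npsi.
have mpsi : measurable_fun setT psi.
  by apply/measurable_EFinP; case/integrableP: npsi.1.
have msg := measurable_sgr.
have : \int[mu]_w (psi w * Num.sg (sin (n.+1%:R^-1 * W w - n.+1%:R^-1 * a)))
    @[n --> \oo] --> \int[mu]_w (psi w * Num.sg (W w - a)).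
  apply: (@dominated_Rcvg _ _ _ _ _ _ (fun w => `|psi w|)).
  - move=> n; apply: measurable_funM => //.
    by apply: measurableT_comp => //; exact: measurable_sin_affine.
  - move=> w; apply: cvgM; first exact: cvg_cst.
    (* For n large the argument (W w - a)/(n+1) lies in (-pi, pi), where sine has the sign of its
       argument: the sequence is eventually constant. *)
    apply: cvg_near_cst; near=> n.
    rewrite -mulrBr.
    have n0 : 0 < n.+1%:R^-1 :> R by rewrite invr_gt0.
    have Wn : `|W w - a| * n.+1%:R^-1 < pi.
      apply: (@le_lt_trans _ _ 1); last by have := @pi_ge2 R; lra.
      rewrite ler_pdivrMr// mul1r; near: n.
      have : \forall n \near \oo, `|W w - a| <= n%:R by exact: nbhs_infty_ger.
      by apply: filterS => n h; rewrite (le_trans h)// ler_nat.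
    have [y0|y0|<-] := ltgtP 0 (W w - a); last by rewrite mulr0 sin0.
    + rewrite !gtr0_sg//; rewrite gtr0_norm// mulrC in Wn.
      by rewrite sin_gt0_pi// Wn andbT mulr_gt0.
    + rewrite !ltr0_sg//; rewrite ltr0_norm// in Wn.
      rewrite -oppr_gt0 -sinN sin_gt0_pi// -mulrN mulrC Wn andbT.
      by rewrite mulr_gt0// oppr_gt0.
  - exact: integrable_norm npsi.1.
  - by move=> n w; rewrite normrM ler_piMr// normr_sg lern1 leq_b1.
under eq_fun do rewrite trig_null_sg//.
move/cvg_lim => <-//; exact: lim_cst.
Unshelve. all: by end_near. Qed.

Lemma trig_null_ray (W : T -> R) a psi : measurable_fun setT W ->
  trig_null mu W psi -> \int[mu]_(w in W @^-1` `]a, +oo[) psi w = 0.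
Proof.
move=> mW npsi; rewrite Rintegral_mkcond patch_indic/=.
have mpsi : measurable_fun setT psi.
  by apply/measurable_EFinP; case/integrableP: npsi.1.
have msg := measurable_sgr.
have msgW b : measurable_fun setT (fun w => Num.sg (W w - b)).
  by apply: measurableT_comp => //; apply: measurable_funB.
(* (1 + sg)/2 equals 1/2 at its threshold. Thresholds decreasing strictly to [a] give the value 0 on
   all of W <= a, boundary included, and eventually 1 on W > a. *)
have : \int[mu]_w (psi w * ((1 + Num.sg (W w - (a + n.+1%:R^-1))) / 2))
    @[n --> \oo] --> \int[mu]_w (psi w * \1_(W @^-1` `]a, +oo[) w).
  apply: (@dominated_Rcvg _ _ _ _ _ _ (fun w => `|psi w|)).
  - move=> n; apply: measurable_funM => //; apply: measurable_funM => //.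
    exact: measurable_funD.
  - move=> w; apply: cvgM; first exact: cvg_cst.
    rewrite indicE; have [aW|aW] := ltP a (W w).
      rewrite mem_set/=; last by rewrite in_itv/= aW.
      have Wa : 0 < W w - a by rewrite subr_gt0.
      apply: cvg_near_cst; near=> n.
      rewrite gtr0_sg; first by field.
      rewrite opprD addrA subr_gt0; near: n.
      exact: (near_infty_natSinv_lt (PosNum Wa)).
    rewrite memNset/=; last by rewrite in_itv/= andbT ltNge aW.
    apply: cvg_near_cst; apply: nearW => n.
    rewrite ltr0_sg; first by field.
    by rewrite subr_lt0 (le_lt_trans aW)// ltrDl invr_gt0.
  - exact: integrable_norm npsi.1.
  - move=> n w; rewrite normrM ler_piMr//.
    have : `|Num.sg (W w - (a + n.+1%:R^-1))| <= 1 by rewrite normr_sg lern1 leq_b1.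
    rewrite !ler_norml; lra.
have -> : (fun n : nat => \int[mu]_w (psi w * ((1 + Num.sg (W w - (a + n.+1%:R^-1))) / 2)))
   = cst 0.
  apply/funext => n.
  transitivity (\int[mu]_w (2^-1 * psi w + 2^-1 * (psi w * Num.sg (W w - (a + n.+1%:R^-1))))).
    by apply: eq_Rintegral => w _; field.
  have i2 : mu.-integrable setT
      (EFin \o (fun w => psi w * Num.sg (W w - (a + n.+1%:R^-1)))).
    apply: integrable_mul_bounded npsi.1 _ (_ : forall w, _ <= 1) => //.
    by move=> w; rewrite normr_sg lern1 leq_b1.
  rewrite RintegralD//.
  - rewrite !RintegralZl//; last exact: npsi.1.
    by rewrite trig_null_sgB// (trig_null_integral npsi) !mulr0 addr0.
  - exact: (integrableZl _ _ npsi.1).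
  - exact: (integrableZl _ _ i2).
move/cvg_lim => <-//; exact: lim_cst.
Unshelve. all: by end_near. Qed.

(** Dynkin's pi-lambda argument; stability under complement is where the zero total integral enters.
    Measurability belongs to the class carried through the induction, since additivity of the
    integral requires it. *)
Lemma sigma_integral_eq0 (G : set (set T)) psi :
  mu.-integrable setT (EFin \o psi) -> setI_closed G ->
  (forall A, G A -> measurable A) -> \int[mu]_w psi w = 0 ->
  (forall A, G A -> \int[mu]_(w in A) psi w = 0) ->
  forall A, <<s G >> A -> measurable A /\ \int[mu]_(w in A) psi w = 0.
Proof.
move=> ipsi GI mG psi0 G0.
rewrite -setI_closed_g_dynkin_g_sigma_algebra//.
apply: smallest_sub => //; last by move=> A GA; split; [exact: mG|exact: G0].
split => //.
- move=> A [mA A0]; split; first exact: measurableC.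
  have := @Rintegral_setU _ _ _ mu A (~` A) psi mA (measurableC mA).
  rewrite setUCr psi0 A0 add0r => <- //.
  by apply/disj_setPCl.
- move=> F tF /all_and2[mF F0]; split; first exact: bigcup_measurable.
  have iF k : mu.-integrable (F k) (EFin \o psi).
    exact: integrableS ipsi.
  rewrite /Rintegral integral_bigcup//; last first.
    by apply: integrableS ipsi => //; exact: bigcup_measurable.
  rewrite eseries0// => i _ _.
  by rewrite -[LHS]fineK ?integrable_fin_num// [fine _]F0.
Qed.

Lemma trig_null_preimage (W : T -> R) (B : set R) psi : measurable_fun setT W ->
  trig_null mu W psi -> measurable B -> \int[mu]_(w in W @^-1` B) psi w = 0.
Proof.
move=> mW npsi mB.
pose G := preimage_set_system setT W (@RGenOInfty.G R).
have := @sigma_integral_eq0 G psi npsi.1.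
move=> /(_ _ _ (trig_null_integral npsi)) h.
suff : <<s G >> (W @^-1` B).
  move/h => []//.
  - move=> _ _ [_ [x ->] <-] [_ [y ->] <-]; exists `]Num.max x y, +oo[%classic.
      by exists (Num.max x y).
    rewrite !setTI -preimage_setI; congr (_ @^-1` _); apply/seteqP; split => z /=.
      by rewrite !in_itv/= !andbT gt_max => /andP.
    by rewrite !in_itv/= !andbT gt_max => -[-> ->].
  - move=> _ [_ [x ->] <-]; exact: mW.
  - move=> _ [_ [x ->] <-]; rewrite setTI; exact: trig_null_ray.
rewrite /G g_sigma_preimageE; exists B; last by rewrite setTI.
by rewrite -RGenOInfty.measurableE.
Qed.

Lemma measurable_lin_comb n (Z : 'I_n -> T -> R) (c : 'I_n -> R) :
  (forall k, measurable_fun setT (Z k)) ->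
  measurable_fun setT (fun w => \sum_(k < n) c k * Z k w).
Proof. by move=> mZ; apply: measurable_sum => k; exact: measurable_funM. Qed.

(** Induction on the dimension, using the one-dimensional result only. With a cosine of the other
    coordinates absorbed into psi, the first coordinate can be restricted to [B ord0]; psi times
    that indicator then satisfies the hypothesis in the remaining coordinates. *)
Lemma trig_null_box n (Z : 'I_n -> T -> R) (B : 'I_n -> set R) psi :
  (forall k, measurable_fun setT (Z k)) -> (forall k, measurable (B k)) ->
  mu.-integrable setT (EFin \o psi) ->
  (forall c b, \int[mu]_w (psi w * cos (\sum_(k < n) c k * Z k w + b)) = 0) ->
  \int[mu]_(w in [set w | forall k, B k (Z k w)]) psi w = 0.
Proof.
elim: n Z B psi => [|n IH] Z B psi mZ mB ipsi npsi.
  rewrite (_ : [set w | _] = setT); last by apply/seteqP; split => // w _ [].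
  rewrite -[RHS](npsi (fun=> 0) 0); apply: eq_Rintegral => w _.
  by rewrite big_ord0 addr0 cos0 mulr1.
pose A := Z ord0 @^-1` B ord0.
have mA : measurable A by rewrite -[A]setTI; exact: mZ.
have mcosV (c : 'I_n -> R) b : measurable_fun setT
    (fun w => cos (\sum_(k < n) c k * Z (lift ord0 k) w + b)).
  apply: measurableT_comp; first by apply: continuous_measurable_fun; exact: continuous_cos.
  by apply: measurable_funD => //; apply: measurable_lin_comb => k.
have npsi' c b : trig_null mu (Z ord0)
    (fun w => psi w * cos (\sum_(k < n) c k * Z (lift ord0 k) w + b)).
  have ipsi' : mu.-integrable setT (EFin \o
      (fun w => psi w * cos (\sum_(k < n) c k * Z (lift ord0 k) w + b))).
    by apply: integrable_mul_bounded ipsi (mcosV c b) _ => w; exact: cos_max.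
  have npsiE s b' : \int[mu]_w
      (psi w * cos (\sum_(k < n) c k * Z (lift ord0 k) w + (s * Z ord0 w + b'))) = 0.
    (* The frequency vector here is [c] with [s] put in front, at index [ord0]. *)
    rewrite -[RHS](npsi (fun k => oapp c s (unlift ord0 k)) b').
    apply: eq_Rintegral => w _; congr (_ * cos _).
    rewrite big_ord_recl/= unlift_none/= addrCA addrA; congr (_ + _ + _).
    by apply: eq_bigr => k _; rewrite liftK.
  have iE s b' : mu.-integrable setT (EFin \o (fun w =>
      psi w * cos (\sum_(k < n) c k * Z (lift ord0 k) w + (s * Z ord0 w + b')))).
    apply: integrable_mul_bounded ipsi _ (fun w => cos_max _).
    apply: measurableT_comp; first by apply: continuous_measurable_fun; exact: continuous_cos.
    apply: measurable_funD; first exact: measurable_lin_comb.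
    by apply: measurable_funD => //; apply: measurable_funM.
  split => // s b'.
  transitivity (\int[mu]_w (2^-1 *
      (psi w * cos (\sum_(k < n) c k * Z (lift ord0 k) w + (s * Z ord0 w + (b + b')))) +
     2^-1 * (psi w * cos (\sum_(k < n) c k * Z (lift ord0 k) w + (- s * Z ord0 w + (b - b')))))).
    apply: eq_Rintegral => w _; set V := \sum_(k < n) _.
    rewrite (_ : V + (s * _ + _) = V + b + (s * Z ord0 w + b')); last by ring.
    rewrite (_ : V + (- s * _ + _) = V + b - (s * Z ord0 w + b')); last by ring.
    by rewrite (cosD (V + b)) (cosB (V + b)); field.
  rewrite RintegralD//; [|exact: (integrableZl _ _ (iE _ _))..].
  by rewrite !RintegralZl// !npsiE !mulr0 addr0.
have -> : [set w | forall k, B k (Z k w)] =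
    [set w | forall k, B (lift ord0 k) (Z (lift ord0 k) w)] `&` A.
  apply/seteqP; split => w /= => [h|[h1 h2] k]; first by split => [k|]; exact: h.
  by case: (unliftP ord0 k) => [j ->|->].
rewrite Rintegral_mkcondr; apply: (IH (fun k => Z (lift ord0 k)) (fun k => B (lift ord0 k))) => //.
  by rewrite -restrict_EFin -integrable_mkcond//; exact: integrableS ipsi.
move=> c b; rewrite -[RHS](trig_null_preimage (mZ ord0) (npsi' c b) (mB ord0)).
rewrite [RHS]Rintegral_mkcond; apply: eq_Rintegral => w _.
by rewrite !patch_indic/= -/A mulrAC.
Qed.

Lemma bigsetU_exists n (F : 'I_n -> set (set T)) A :
  (\big[setU/set0]_(i < n) F i) A <-> exists i, F i A.
Proof.
split => [|[i FA]]; last by rewrite (bigD1 i)//=; left.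
elim/big_ind : _ => [//|S1 S2 h1 h2 [/h1|/h2]//|i _ FA]; by exists i.
Qed.

(** Box events are stable under intersection and include the generators of [g_sigma_preimage Z].
    Measurability in [T] is returned as well, because callers know only that [A] lies in the
    generated sigma-algebra. *)
Theorem trig_null_sigma n (Z : 'I_n -> T -> R) psi :
  (forall k, measurable_fun setT (Z k)) -> mu.-integrable setT (EFin \o psi) ->
  (forall c b, \int[mu]_w (psi w * cos (\sum_(k < n) c k * Z k w + b)) = 0) ->
  forall A, g_sigma_preimage Z A ->
  measurable A /\ \int[mu]_(w in A) psi w = 0.
Proof.
move=> mZ ipsi npsi.
pose G := [set A | exists B : 'I_n -> set R, (forall k, measurable (B k)) /\
  A = [set w | forall k, B k (Z k w)]].
have psi0 : \int[mu]_w psi w = 0.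
  rewrite -[RHS](npsi (fun=> 0) 0); apply: eq_Rintegral => w _.
  by rewrite big1 => [|k _]; rewrite ?mul0r// addr0 cos0 mulr1.
have mG A : G A -> measurable A.
  move=> [B [mB ->]].
  rewrite (_ : [set w | _] = \big[setI/setT]_(k < n) (Z k @^-1` B k)).
    by apply: bigsetI_measurable => k _; rewrite -[X in measurable X]setTI; exact: mZ.
  apply/seteqP; split => w /=.
    by move=> h; apply: (@big_ind _ (fun S : set T => S w)) => // k _; exact: h.
  by move=> + k; rewrite (bigD1 k)//= => -[].
have sub : g_sigma_preimage Z `<=` <<s G >>.
  apply: smallest_sub; first exact: smallest_sigma_algebra.
  move=> A /bigsetU_exists[i [B mB <-]]; apply: sub_sigma_algebra.
  exists (fun k => if k == i then B else setT); split => [k|]; first by case: ifP.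
  rewrite setTI; apply/seteqP; split => w /= => [h k|/(_ i)]; last by rewrite eqxx.
  by case: eqP => [->|].
move=> A /sub; apply: sigma_integral_eq0 => //.
- move=> _ _ [B1 [mB1 ->]] [B2 [mB2 ->]]; exists (fun k => B1 k `&` B2 k).
  split => [k|]; first exact: measurableI.
  by apply/seteqP; split => w /= => [[h1 h2] k|h]; [|split => k; have []:= h k].
- by move=> _ [B [mB ->]]; exact: trig_null_box.
Qed.

End trig_uniqueness.

(** * Normal laws *)

Section normal_density.
Context (R : realType).
Variables (m s : R).
Hypothesis s0 : s != 0.
Local Notation mu := (@lebesgue_measure R).
Local Notation p := (normal_pdf m s).

(** The Radon-Nikodym derivative of the normal law agrees almost everywhere with the explicit
    density, both having the same integral over every measurable set. The nonnegative case comes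
    apart because it yields the integrability required for signed [f]. *)
Lemma integral_normal_pdf_ge0 (f : R -> R) : measurable_fun setT f ->
  (forall x, 0 <= f x) ->
  (\int[normal_prob m s]_x (f x)%:E = \int[mu]_x (f x * p x)%:E)%E.
Proof.
move=> mf f0.
have dom := normal_prob_dominates m s.
rewrite -(Radon_Nikodym_SigmaFinite.change_of_variables dom)//; last first.
  exact/measurable_EFinP.
apply: ae_eq_integral => //.
- apply: emeasurable_funM; first exact/measurable_EFinP.
  exact: measurable_int (Radon_Nikodym_SigmaFinite.f_integrable dom).
- apply/measurable_EFinP; apply: measurable_funM => //.
  exact: measurable_normal_pdf.
- under [X in ae_eq _ _ _ X]eq_fun do rewrite EFinM.
  apply: ae_eqe_mul2l; apply: integral_ae_eq => //.
  + exact: Radon_Nikodym_SigmaFinite.f_integrable.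
  + by apply/measurable_EFinP; exact: measurable_normal_pdf.
  + by move=> A _ mA; rewrite -Radon_Nikodym_SigmaFinite.f_integral.
Qed.

Lemma integrable_normal_prob (f : R -> R) : measurable_fun setT f ->
  mu.-integrable setT (EFin \o (fun x => f x * p x)) ->
  (normal_prob m s).-integrable setT (EFin \o f).
Proof.
move=> mf /integrableP[_ fi]; apply/integrableP; split; first exact/measurable_EFinP.
rewrite integral_normal_pdf_ge0//; last exact: measurableT_comp.
apply: le_lt_trans fi; rewrite le_eqVlt; apply/orP; left; apply/eqP.
by apply: eq_integral => x _ /=; rewrite normrM (ger0_norm (normal_pdf_ge0 _ _ _)).
Qed.

Lemma Rintegral_normal_prob (f : R -> R) : measurable_fun setT f ->
  mu.-integrable setT (EFin \o (fun x => f x * p x)) ->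
  \int[normal_prob m s]_x f x = \int[mu]_x (f x * p x).
Proof.
move=> mf fi; have dom := normal_prob_dominates m s.
have fn := integrable_normal_prob mf fi.
rewrite /Rintegral -(Radon_Nikodym_change_of_variables dom measurableT fn).
congr fine; apply: ae_eq_integral => //.
- apply: emeasurable_funM; first exact/measurable_EFinP.
  exact: measurable_int (Radon_Nikodym_integrable _).
- apply/measurable_EFinP; apply: measurable_funM => //.
  exact: measurable_normal_pdf.
- under [X in ae_eq _ _ _ X]eq_fun do rewrite EFinM.
  apply: ae_eqe_mul2l; apply: integral_ae_eq => //.
  + exact: Radon_Nikodym_integrable.
  + by apply/measurable_EFinP; exact: measurable_normal_pdf.
  + by move=> A _ mA; rewrite -Radon_Nikodym_integral.
Qed.

(** A normal density of doubled width absorbs quadratic growth. Moments are thus dominated by a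
    function already known to be integrable, and boundary terms by one that visibly tends to 0. *)
Lemma normal_pdf_wide_bound : exists2 K : R, 0 <= K &
  forall x, (1 + (x - m) ^+ 2) * p x <= K * normal_pdf m (2 * s) x.
Proof.
have s20 : 2 * s != 0 by rewrite mulf_neq0// pnatr_eq0.
have v0 : 0 < s ^+ 2 by rewrite exprn_even_gt0.
have pk0 := normal_peak_gt0 s20; have pk1 := normal_peak_gt0 s0.
exists ((1 + 4 * s ^+ 2) * (normal_peak s / normal_peak (2 * s))).
  by rewrite mulr_ge0// ?divr_ge0 ?ltW//; lra.
move=> x; rewrite !normal_pdfE//.
rewrite [leRHS](_ : _ = normal_peak s * ((1 + 4 * s ^+ 2) * normal_fun m (2 * s) x)); last first.
  by field; rewrite gt_eqF.
rewrite mulrCA ler_wpM2l ?normal_peak_ge0// /normal_fun.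
set y := (x - m) ^+ 2; have y0 : 0 <= y by rewrite sqr_ge0.
(* [u] is the gap between the two exponents, y/(2s^2) - y/(8s^2). The bound follows from 1 <= e^u
   and u <= e^u, as y = (8/3) s^2 u <= 4 s^2 e^u. *)
set u := 3 / 8 * y / s ^+ 2.
have u0 : 0 <= u by apply: divr_ge0; [apply: mulr_ge0 => //; lra|exact: ltW].
have -> : expR (- y / (s ^+ 2 *+ 2)) = expR (- y / ((2 * s) ^+ 2 *+ 2)) * expR (- u).
  by rewrite -expRD; congr expR; rewrite /u; field; rewrite ?s0.
rewrite mulrCA mulrC ler_wpM2r ?expR_ge0//.
rewrite expRN ler_pdivrMr ?expR_gt0//.
have e1 : 1 <= expR u by rewrite -expR0 ler_expR.
have e2 : 1 + u <= expR u := expR_ge1Dx u.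
have yE : y = 8 / 3 * s ^+ 2 * u.
  by rewrite /u; field; rewrite s0.
rewrite mulrDl mul1r lerD// yE.
rewrite (_ : 4 * _ * _ = 4 * (s ^+ 2 * expR u)); last by ring.
rewrite (_ : 8 / 3 * _ * _ = 8 / 3 * (s ^+ 2 * u)); last by ring.
have : s ^+ 2 * u <= s ^+ 2 * expR u by rewrite ler_pM2l//; lra.
have : 0 <= s ^+ 2 * u by rewrite mulr_ge0// ltW.
lra.
Qed.

Lemma integrable_normal_quad (f : R -> R) (A : R) : measurable_fun setT f ->
  (forall x, `|f x| <= A * (1 + (x - m) ^+ 2)) ->
  mu.-integrable setT (EFin \o (fun x => f x * p x)).
Proof.
move=> mf fA; have [K K0 hK] := normal_pdf_wide_bound.
apply: (le_integrable measurableT _ _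
    (integrableZl measurableT (`|A| * K) (integrable_normal_pdf m (2 * s)))).
  apply/measurable_EFinP; apply: measurable_funM => //.
  exact: measurable_normal_pdf.
move=> x _ /=; rewrite lee_fin !normrM !(ger0_norm (normal_pdf_ge0 _ _ _)).
rewrite normr_id (ger0_norm K0) -mulrA.
apply: le_trans (ler_wpM2l (normr_ge0 A) (hK x)).
rewrite mulrA ler_wpM2r ?normal_pdf_ge0//.
apply: (le_trans (fA x)); rewrite ler_wpM2r ?ler_norm//.
by rewrite addr_ge0// sqr_ge0.
Qed.

Lemma is_derive_normal_pdf (x : R) :
  is_derive x (1 : R) p (- (x - m) / s ^+ 2 * p x).
Proof.
have pE : p = normal_peak s \*:
    (expR \o ((- (s ^+ 2 *+ 2)^-1) \*: ((id - cst m) ^+ 2 : R -> R))) :> (R -> R).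
  apply/funext => y; rewrite normal_pdfE// /normal_fun/= /GRing.scale/= !fctE.
  by congr (_ * expR _); field.
rewrite pE; apply: is_derive_eq.
rewrite /= /GRing.scale/= !fctE subr0 expr1; field.
by rewrite s0.
Qed.

Lemma cvg_normal_pdf_tail (e : R) : `|e| = 1 ->
  normal_pdf m (2 * s) (m + e * n%:R) @[n --> \oo] --> (0 : R).
Proof.
move=> e1; have s20 : 2 * s != 0 by rewrite mulf_neq0// pnatr_eq0.
have v0 : 0 < (8 * s ^+ 2)^-1 by rewrite invr_gt0 mulr_gt0// exprn_even_gt0.
set c := (8 * s ^+ 2)^-1 in v0.
apply: (@squeeze_cvgr _ _ _ _ (cst 0)
  (fun n => normal_peak (2 * s) * expR (- c) ^+ n)); last 2 first.
- exact: cvg_cst.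
- rewrite -[X in _ --> X](mulr0 (normal_peak (2 * s))).
  apply: cvgM; first exact: cvg_cst.
  by apply: cvg_expr; rewrite ger0_norm ?expR_ge0// expR_lt1 oppr_lt0.
apply: nearW => n; rewrite normal_pdf_ge0/= normal_pdfE//.
rewrite ler_wpM2l ?normal_peak_ge0// /normal_fun -expRM_natl ler_expR.
rewrite (addrC m) addrK exprMn -[e ^+ 2]real_normK ?num_real// e1 expr1n mul1r.
rewrite (_ : - _ / _ = - (c * n%:R ^+ 2)); last by rewrite /c; field; rewrite s0.
rewrite mulrN lerN2 mulrC ler_pM2l// expr2 -natrM ler_nat.
by case: n => // n; rewrite leq_pmulr.
Qed.

(** Integration by parts: p' = -(x - m)/s^2 p makes [h] the derivative of s^2 f p. The growth bound
    on f kills the boundary terms; the other two give integrability of each side. *)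
Lemma stein_identity (f f' : R -> R) (A : R) :
  (forall x : R, is_derive x (1 : R) f (f' x)) -> continuous f' ->
  (forall x, `|f x| <= A * (1 + (x - m) ^+ 2)) ->
  (forall x, `|f' x| <= A * (1 + (x - m) ^+ 2)) ->
  (forall x, `|(x - m) * f x| <= A * (1 + (x - m) ^+ 2)) ->
  \int[mu]_x ((x - m) * f x * p x) = s ^+ 2 * \int[mu]_x (f' x * p x).
Proof.
move=> df cf' fA f'A xfA.
have cf : continuous f.
  by move=> x; apply/differentiable_continuous/derivable1_diffP; case: (df x).
have cp : continuous p by exact: continuous_normal_pdf.
have mf : measurable_fun setT f by exact: continuous_measurable_fun.
have mf' : measurable_fun setT f' by exact: continuous_measurable_fun.
have mxf : measurable_fun setT (fun x : R => (x - m) * f x).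
  by apply: measurable_funM => //; apply: measurable_funB.
have i1 := integrable_normal_quad mf' f'A.
have i2 := integrable_normal_quad mxf xfA.
pose h (x : R) := s ^+ 2 * (f' x * p x) - (x - m) * f x * p x.
have ih : mu.-integrable setT (EFin \o h).
  exact: (integrableB measurableT (integrableZl measurableT (s ^+ 2) i1) i2).
have hE : \int[mu]_x h x =
    s ^+ 2 * \int[mu]_x (f' x * p x) - \int[mu]_x ((x - m) * f x * p x).
  rewrite RintegralB// ?RintegralZl//.
  exact: (integrableZl measurableT (s ^+ 2) i1).
suff : \int[mu]_x h x = 0 by rewrite hE => /subr0_eq.
pose F (x : R) := s ^+ 2 * (f x * p x).
have dF (x : R) : is_derive x (1 : R) F (h x).
  have dp := is_derive_normal_pdf x; have dfx := df x.
  have -> : F = s ^+ 2 \*: (f * p) :> (R -> R) by [].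
  apply: is_derive_eq; rewrite /h /GRing.scale/=; field.
  by rewrite s0.
have cF : continuous F.
  by move=> x; apply/differentiable_continuous/derivable1_diffP; case: (dF x).
have ch : continuous h.
  move=> x; apply: cvgB; apply: cvgM; [exact: cvg_cst| |  |exact: cp].
    by apply: cvgM; [exact: cf'|exact: cp].
  apply: cvgM; last exact: cf.
  by apply: cvgB; [exact: cvg_id|exact: cvg_cst].
have Ftail e : `|e| = 1 -> F (m + e * n%:R) @[n --> \oo] --> (0 : R).
  move=> e1; have [K K0 hK] := normal_pdf_wide_bound.
  apply: norm_cvg0.
  apply: (@squeeze_cvgr _ _ _ _ (cst 0)
     (fun n => s ^+ 2 * (`|A| * K) * normal_pdf m (2 * s) (m + e * n%:R))).
  - apply: nearW => n; rewrite normr_ge0/= /F normrM (normrM (f _)) (ger0_norm (sqr_ge0 s)).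
    rewrite -mulrA ler_wpM2l ?sqr_ge0// -mulrA.
    apply: le_trans (ler_wpM2l (normr_ge0 A) (hK _)).
    rewrite (ger0_norm (normal_pdf_ge0 _ _ _)) mulrA ler_wpM2r ?normal_pdf_ge0//.
    apply: (le_trans (fA _)); rewrite ler_wpM2r ?ler_norm//.
    by rewrite addr_ge0// sqr_ge0.
  - exact: cvg_cst.
  - rewrite -[X in _ --> X](mulr0 (s ^+ 2 * (`|A| * K))).
    by apply: cvgM; [exact: cvg_cst|exact: cvg_normal_pdf_tail].
(* The truncated integrals have two limits: the full integral by dominated convergence, and 0 by the
   fundamental theorem of calculus and the tails of [F]. *)
have l1 : \int[mu]_x (h x * \1_`[m - n%:R, m + n%:R] x) @[n --> \oo] -->
    \int[mu]_x h x.
  apply: (@dominated_Rcvg _ _ _ mu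
    (fun n x => h x * \1_`[m - n%:R, m + n%:R] x) h (fun x => `|h x|)).
  - move=> n; apply: measurable_funM; first exact: continuous_measurable_fun.
    exact: measurable_indic.
  - move=> x; rewrite -[X in _ --> X]mulr1; apply: cvgM; first exact: cvg_cst.
    apply: cvg_near_cst.
    have : \forall n \near \oo, `|x - m| <= n%:R by exact: nbhs_infty_ger.
    apply: filterS => n; rewrite ler_norml => xn; rewrite indicE mem_set//=.
    by rewrite in_itv/=; lra.
  - exact: integrable_norm.
  - move=> n x; rewrite normrM ler_piMr// indicE normr_nat.
    by case: (_ \in _).
have l2 : \int[mu]_x (h x * \1_`[m - n%:R, m + n%:R] x) @[n --> \oo] --> (0 : R).
  rewrite -(subrr (0 : R)).
  have N1 : `|-1| = 1 :> R by rewrite normrN1.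
  apply: cvg_trans (cvgB (Ftail 1 (normr1 _)) (Ftail (-1) N1)).
  apply: near_eq_cvg; exists 1%N => // n /= n0.
  rewrite [LHS]/(_ - _)/= mul1r mulN1r.
  have := @Rintegral_mkcond _ _ _ mu `[m - n%:R, m + n%:R] h.
  rewrite patch_indic /= => <-.
  rewrite /Rintegral (@continuous_FTC2 _ h F)//.
  - by rewrite ltrD2l gtrN// ltr0n.
  - exact: continuous_subspaceT.
  - split => [x _||]; first by case: (dF x).
      by apply: cvg_at_right_filter; exact: cF.
    by apply: cvg_at_left_filter; exact: cF.
  - by move=> x _; rewrite derive1E; case: (dF x).
exact: (cvg_unique _ l1 l2).
Qed.
End normal_density.

Section normal_moments.
Context (R : realType).
Variables (m s : R).
Hypothesis s0 : s != 0.
Local Notation mu := (@lebesgue_measure R).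
Local Notation p := (normal_pdf m s).

Lemma normal_mean : \int[mu]_x ((x - m) * p x) = 0.
Proof.
have q0 x : 0 <= (x - m) ^+ 2 by rewrite sqr_ge0.
transitivity (\int[mu]_x ((x - m) * cst 1 x * p x)).
  by apply: eq_Rintegral => x _; rewrite /= mulr1.
rewrite (@stein_identity R m s s0 (cst 1) (cst 0) 2).
- by under eq_Rintegral do rewrite /= mul0r; rewrite Rintegral_cst// mul0r mulr0.
- by move=> x; exact: cst_continuous.
- by move=> x /=; rewrite normr1; have := q0 x; lra.
- by move=> x /=; rewrite normr0; have := q0 x; lra.
- move=> x /=; rewrite mulr1 ler_norml; have := q0 x.
  have := sqr_ge0 (x - m - 1); have := sqr_ge0 (x - m + 1); lra.
Qed.

Lemma normal_variance : \int[mu]_x ((x - m) ^+ 2 * p x) = s ^+ 2.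
Proof.
have q0 x : 0 <= (x - m) ^+ 2 by rewrite sqr_ge0.
under eq_Rintegral do rewrite expr2.
have dB (x : R) : is_derive x (1 : R) (fun x => x - m) (cst 1 x).
  have -> : (fun x => x - m) = (id - cst m : R -> R) by [].
  by apply: is_derive_eq; rewrite subr0.
rewrite (@stein_identity R m s s0 (fun x => x - m) (cst 1) 2).
- under eq_Rintegral do rewrite mul1r.
  by rewrite /Rintegral integral_normal_pdf/= mulr1.
- by move=> x; exact: cst_continuous.
- move=> x; rewrite ler_norml; have := q0 x.
  have := sqr_ge0 (x - m - 1); have := sqr_ge0 (x - m + 1); lra.
- by move=> x /=; rewrite normr1; have := q0 x; lra.
- move=> x; rewrite -expr2 ger0_norm ?sqr_ge0//; have := q0 x; lra.
Qed.

(** With C(t) the mean of cos(t(x - m) + b), differentiating under the integral and applying Stein's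
    identity to the sine gives C' = -s^2 t C, a linear equation to be solved between t = 0 and t =
    1. *)
Lemma normal_char_fun b : \int[mu]_x (cos (x - m + b) * p x) = expR (- s ^+ 2 / 2) * cos b.
Proof.
pose f (t x : R) := cos (t * (x - m) + b) * p x.
have q0 x : 0 <= (x - m) ^+ 2 by rewrite sqr_ge0.
have dtrig (x t : R) : is_derive t (1 : R) (fun t => t * (x - m) + b) (x - m).
  have -> : (fun t => t * (x - m) + b) = ((x - m) \*: id + cst b : R -> R).
    by apply/funext => u; rewrite !fctE /GRing.scale/= mulrC.
  by apply: is_derive_eq; rewrite addr0 /GRing.scale/= mulr1.
have dtrigx (x t : R) : is_derive x (1 : R) (fun x => t * (x - m) + b) t.
  have -> : (fun x => t * (x - m) + b) = (t \*: (id - cst m) + cst b : R -> R).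
    by apply/funext => u; rewrite !fctE /GRing.scale/=.
  by apply: is_derive_eq; rewrite addr0 subr0 /GRing.scale/= mulr1.
have maff t : measurable_fun setT (fun x : R => t * (x - m) + b).
  apply: measurable_funD => //; apply: measurable_funM => //.
  exact: measurable_funB.
have mcos t : measurable_fun setT (fun x : R => cos (t * (x - m) + b)).
  apply: measurableT_comp => //; apply: continuous_measurable_fun.
  exact: continuous_cos.
have msin t : measurable_fun setT (fun x : R => sin (t * (x - m) + b)).
  apply: measurableT_comp => //; apply: continuous_measurable_fun.
  exact: continuous_sin.
have icos t : mu.-integrable setT (EFin \o f t).
  apply: (integrable_normal_quad s0 (mcos t) (A := 1)) => x.
  by rewrite mul1r (le_trans (cos_max _))//; have := q0 x; lra.
have dft (x t : R) : is_derive t (1 : R) (f ^~ x) (- ((x - m) * sin (t * (x - m) + b) * p x)).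
  have -> : f ^~ x = p x \*: (cos \o (fun t => t * (x - m) + b)) :> (R -> R).
    by apply/funext => u; rewrite /f /GRing.scale/= mulrC.
  have h := dtrig x t; apply: is_derive_eq; rewrite /GRing.scale/=; ring.
pose C t := \int[mu]_x f t x.
have xb x y : `|y| <= 1 -> `|(x - m) * y| <= 1 + (x - m) ^+ 2.
  move=> y1; rewrite normrM; apply: (@le_trans _ _ (`|x - m| * 1)).
    by rewrite ler_wpM2l.
  rewrite mulr1 ler_norml; have := q0 x.
  have := sqr_ge0 (x - m - 1); have := sqr_ge0 (x - m + 1); lra.
have dC t : is_derive t (1 : R) C (- (s ^+ 2 * t * C t)).
  have iG : mu.-integrable setT (EFin \o (fun x => (1 + (x - m) ^+ 2) * p x)).
    apply: (@integrable_normal_quad _ m s s0 _ 1).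
      apply: measurable_funD => //; apply: measurable_funX.
      exact: measurable_funB.
    by move=> x; rewrite mul1r ger0_norm// addr_ge0.
  have d1 y x : partial1of2 f y x = - ((x - m) * sin (y * (x - m) + b) * p x).
    by rewrite partial1of2E; have [_ ->] := dft x y.
  have tI : `](t - 1), (t + 1)[%classic t by rewrite /= in_itv/=; lra.
  have h1 x y : `](t - 1), (t + 1)[%classic x -> setT y -> derivable (f ^~ y) x 1.
    by move=> _ _; have [] := dft y x.
  have h2 y : 0 <= (1 + (y - m) ^+ 2) * p y.
    by rewrite mulr_ge0 ?normal_pdf_ge0// addr_ge0.
  have h3 x y : `](t - 1), (t + 1)[%classic x -> setT y ->
      `|partial1of2 f x y| <= (1 + (y - m) ^+ 2) * p y.
    move=> _ _; rewrite d1 normrN normrM (ger0_norm (normal_pdf_ge0 _ _ _)).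
    by rewrite ler_wpM2r ?normal_pdf_ge0// xb// sin_max.
  apply: DeriveDef.
    exact: (derivable_under_integral measurableT tI (fun x _ => icos x) h1 h2 iG h3).
  rewrite -derive1E (differentiation_under_integral measurableT tI (fun x _ => icos x) h1 h2 iG h3).
  under eq_Rintegral do rewrite d1 -mulN1r.
  have At x y : `|y| <= 1 -> `|t| * `|y| <= (1 + `|t|) * (1 + (x - m) ^+ 2).
    move=> y1; apply: (@le_trans _ _ (`|t| * 1)); first by rewrite ler_wpM2l.
    have : 0 <= `|t| * (x - m) ^+ 2 by rewrite mulr_ge0.
    by have := q0 x; rewrite mulr1 mulrDl mulrDr; lra.
  have A1 x : 0 <= `|t| * (1 + (x - m) ^+ 2) by rewrite mulr_ge0// addr_ge0.
  rewrite RintegralZl//; last first.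
    apply: (@integrable_normal_quad _ m s s0 _ 1).
      by apply: measurable_funM => //; apply: measurable_funB.
    by move=> x; rewrite mul1r xb// sin_max.
  have dS (x : R) : is_derive x (1 : R) (fun x => sin (t * (x - m) + b))
      (t * cos (t * (x - m) + b)).
    have h := dtrigx x t; have -> : (fun x => sin (t * (x - m) + b)) =
      sin \o (fun x => t * (x - m) + b) :> (R -> R) by [].
    by apply: is_derive_eq; rewrite mulrC.
  rewrite (@stein_identity R m s s0 (fun x => sin (t * (x - m) + b))
    (fun x => t * cos (t * (x - m) + b)) (1 + `|t|)).
  - rewrite mulN1r; congr (- _); rewrite -mulrA; congr (_ * _).
    rewrite -RintegralZl//; apply: eq_Rintegral => x _; by rewrite mulrA.
  - move=> x; apply: cvgM; first exact: cvg_cst.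
    apply: (@continuous_comp _ _ _ (fun x : R => t * (x - m) + b)); last exact: continuous_cos.
    by apply/differentiable_continuous/derivable1_diffP; case: (dtrigx x t).
  - move=> x; rewrite (le_trans (sin_max _))// mulrDl mul1r.
    by have := A1 x; have := q0 x; lra.
  - by move=> x; rewrite normrM At// cos_max.
  - move=> x; rewrite (le_trans (xb _ _ (sin_max _)))// mulrDl mul1r.
    by have := A1 x; lra.
(* Multiplication by the integrating factor makes the product constant; comparing t = 1 with t = 0
   gives the formula. *)
pose D t := C t * expR (s ^+ 2 / 2 * t ^+ 2).
have dD (t : R) : is_derive t (1 : R) D 0.
  have -> : D = (C * (expR \o ((s ^+ 2 / 2) \*: (id ^+ 2 : R -> R))) : R -> R).
    by apply/funext.
  have h := dC t; apply: is_derive_eq.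
  by rewrite /GRing.scale/= expr1; field.
have := is_derive_0_is_cst 1 0 dD.
rewrite /D /C /f expr1n expr0n/= mulr0 expR0 !mulr1.
under eq_Rintegral do rewrite mul1r.
under [in X in _ = X -> _]eq_Rintegral do rewrite mul0r add0r.
rewrite RintegralZl//; last exact: integrable_normal_pdf.
rewrite /Rintegral integral_normal_pdf/= mulr1 => <-.
by rewrite mulrCA -expRD mulNr addrC subrr expR0 mulr1.
Qed.

Lemma normal_prob_itv_gt0 (l e : R) : 0 < e ->
  (0 < normal_prob m s `](l - e)%R, (l + e)%R[%classic)%E.
Proof.
(* [K] bounds |x - m| on the interval, so [c] is a positive lower bound for the density there. *)
move=> e0; pose K := `|l - m| + e.
pose c := normal_peak s * expR (- K ^+ 2 / (s ^+ 2 *+ 2)).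
have c0 : 0 < c by rewrite mulr_gt0 ?normal_peak_gt0 ?expR_gt0.
apply: (@lt_le_trans _ _ (\int[mu]_(x in `](l - e)%R, (l + e)%R[) c%:E)%E).
  rewrite integral_cst//= lebesgue_measure_itv/= lte_fin ifT; last lra.
  by rewrite -EFinB -EFinM lte_fin mulr_gt0//; lra.
apply: ge0_le_integral => //=.
- by move=> x _; rewrite lee_fin ltW.
- by apply/measurable_EFinP/measurable_funTS; exact: measurable_normal_pdf.
- move=> x; rewrite in_itv/= => xl; rewrite lee_fin normal_pdfE// /c.
  rewrite ler_wpM2l ?normal_peak_ge0// /normal_fun ler_expR.
  have v0 : 0 < s ^+ 2 *+ 2 by rewrite pmulrn_lgt0// exprn_even_gt0.
  rewrite ler_pM2r ?invr_gt0// lerN2 -[leLHS]real_normK ?num_real//.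
  apply: lerXn2r; [by rewrite nnegrE|by rewrite nnegrE addr_ge0// ltW|].
  rewrite (_ : x - m = (l - m) + (x - l)); last by ring.
  rewrite (le_trans (ler_normD _ _))// lerD2l ler_norml; lra.
Qed.

End normal_moments.

Section law_transfer.
Context (d : measure_display) (T : measurableType d) (R : realType).
Variables (P : probability T R) (Y : T -> measurableTypeR R).
Variable nu : {measure set (measurableTypeR R) -> \bar R}.
Hypothesis mY : measurable_fun setT Y.
Hypothesis law : forall B : set (measurableTypeR R), measurable B -> pushforward P Y B = nu B.

Lemma integrable_law (f : measurableTypeR R -> R) : measurable_fun setT f ->
  nu.-integrable setT (EFin \o f) -> P.-integrable setT (EFin \o (f \o Y)).
Proof.
move=> mf /integrableP[_ fi]; apply/integrableP; split.
  by apply/measurable_EFinP; exact: measurableT_comp.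
apply: le_lt_trans fi; rewrite -[leRHS](@eq_measure_integral _ _ _ _ nu (pushforward P Y)).
  rewrite (ge0_integral_pushforward mY)//.
  by do 2 apply: measurableT_comp => //; exact/measurable_EFinP.
by move=> A mA _; exact: law.
Qed.

Lemma Rintegral_law (f : measurableTypeR R -> R) : measurable_fun setT f ->
  nu.-integrable setT (EFin \o f) -> \int[P]_w f (Y w) = \int[nu]_x f x.
Proof.
move=> mf fi; rewrite /Rintegral.
rewrite -[in RHS](@eq_measure_integral _ _ _ _ nu (pushforward P Y)).
  rewrite (integral_pushforward mY)//.
    exact/measurable_EFinP.
  exact: integrable_law.
by move=> A mA _; exact: law.
Qed.

End law_transfer.

Section gaussian_variables.
Context (d : measure_display) (T : measurableType d) (R : realType).
Variable P : probability T R.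

(** A description common to point masses (v = 0) and normal laws, so that the two are distinguished
    only once. The support clause asks for v > 0 because a constant charges a single point. *)
Record gaussian_spec (Y : T -> R) (m v : R) : Prop := GaussianSpec {
  gspec_int : P.-integrable setT (EFin \o Y);
  gspec_mean : \int[P]_w Y w = m;
  gspec_int2 : P.-integrable setT (EFin \o (fun w => (Y w - m) ^+ 2));
  gspec_var : \int[P]_w (Y w - m) ^+ 2 = v;
  gspec_char : forall b, \int[P]_w cos (Y w - m + b) = expR (- v / 2) * cos b;
  gspec_supp : 0 < v -> forall l e, 0 < e ->
    (0 < P (Y @^-1` `](l - e)%R, (l + e)%R[%classic))%E }.

Lemma Rintegral_probability_cst (r : R) : \int[P]_w r = r.
Proof. by rewrite /Rintegral integral_cst//= probability_setT mule1. Qed.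

Lemma integrable_dirac d' (X : measurableType d') (a : X) (f : X -> R) : measurable_fun setT f ->
  (\d_a : {measure set X -> \bar R}).-integrable setT (EFin \o f).
Proof.
move=> mf; apply/integrableP; split; first exact/measurable_EFinP.
rewrite integral_dirac//.
  by rewrite diracT mul1e/= ltry.
by do 2 apply: measurableT_comp => //; exact/measurable_EFinP.
Qed.

Lemma Rintegral_dirac d' (X : measurableType d') (a : X) (f : X -> R) : measurable_fun setT f ->
  \int[(\d_a : {measure set X -> \bar R})]_x f x = f a.
Proof.
move=> mf; rewrite /Rintegral integral_dirac//; last exact/measurable_EFinP.
by rewrite diracT mul1e.
Qed.

Lemma gaussianP (Y : T -> R) : measurable_fun setT Y -> gaussian P Y ->
  exists m v, gaussian_spec Y m v.
Proof.
move=> mY [m [s]]; have [_|s0] := eqVneq s 0 => law.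
  have lawd := law : forall B : set (measurableTypeR R), measurable B ->
    pushforward P Y B = (\d_(m : measurableTypeR R) : {measure set (measurableTypeR R) -> \bar R}) B.
  have mB : measurable_fun setT (fun x : R => x - m) by exact: measurable_funB.
  have mq : measurable_fun setT (fun x : R => (x - m) ^+ 2) by exact: measurable_funX.
  exists m, 0; split; last by rewrite ltxx.
  - exact: (integrable_law mY lawd (@measurable_id _ _ setT) (integrable_dirac _ _)).
  - rewrite (Rintegral_law mY lawd (@measurable_id _ _ setT))//.
      exact: Rintegral_dirac.
    exact: integrable_dirac.
  - exact: (integrable_law mY lawd mq (integrable_dirac (m : measurableTypeR R) mq)).
  - rewrite (Rintegral_law mY lawd mq (integrable_dirac (m : measurableTypeR R) mq)).
    by rewrite Rintegral_dirac// subrr expr0n.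
  - move=> b.
    have mc : measurable_fun setT (fun x : R => cos (x - m + b)).
      apply: measurableT_comp; last exact: measurable_funD.
      by apply: continuous_measurable_fun; exact: continuous_cos.
    rewrite (Rintegral_law mY lawd mc (integrable_dirac (m : measurableTypeR R) mc)).
    by rewrite Rintegral_dirac// subrr add0r oppr0 mul0r expR0 mul1r.
pose nu : {measure set (measurableTypeR R) -> \bar R} := normal_prob m s.
have lawn := law : forall B : set (measurableTypeR R), measurable B -> pushforward P Y B = nu B.
have mB : measurable_fun setT (fun x : R => x - m) by exact: measurable_funB.
have mq : measurable_fun setT (fun x : R => (x - m) ^+ 2) by exact: measurable_funX.
have mc b : measurable_fun setT (fun x : R => cos (x - m + b)).
  apply: measurableT_comp; last exact: measurable_funD.
  by apply: continuous_measurable_fun; exact: continuous_cos.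
have iq := @integrable_normal_quad R m s s0 _ 1 mq.
have iB := @integrable_normal_quad R m s s0 _ 1 mB.
have ic b := @integrable_normal_quad R m s s0 _ 1 (mc b).
have q0 x : 0 <= (x - m) ^+ 2 by rewrite sqr_ge0.
have {}iq : lebesgue_measure.-integrable setT
    (EFin \o (fun x => (x - m) ^+ 2 * normal_pdf m s x)).
  by apply: iq => x; rewrite mul1r ger0_norm//; have := q0 x; lra.
have {}iB : lebesgue_measure.-integrable setT
    (EFin \o (fun x => (x - m) * normal_pdf m s x)).
  apply: iB => x; rewrite mul1r ler_norml; have := q0 x.
  have := sqr_ge0 (x - m - 1); have := sqr_ge0 (x - m + 1); lra.
have {}ic b : lebesgue_measure.-integrable setT
    (EFin \o (fun x => cos (x - m + b) * normal_pdf m s x)).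
  by apply: ic => x; rewrite mul1r (le_trans (cos_max _))//; have := q0 x; lra.
have iYB := integrable_law mY lawn mB (integrable_normal_prob mB iB).
have YBE := Rintegral_law mY lawn mB (integrable_normal_prob mB iB).
have icst : P.-integrable setT (EFin \o cst m).
  exact: finite_measure_integrable_cst.
have iY : P.-integrable setT (EFin \o Y).
  have := integrableD measurableT iYB icst; apply: eq_integrable => // w _ /=.
  by rewrite -EFinD subrK.
exists m, (s ^+ 2); split => //.
(* Stein's identity delivers the centred first moment, so the mean is read off from E[Y - m] = 0. *)
- apply/eqP; rewrite -subr_eq0 -(normal_mean m s0) -(Rintegral_normal_prob mB iB) -YBE.
  by rewrite RintegralB// Rintegral_probability_cst.
- exact: (integrable_law mY lawn mq (integrable_normal_prob mq iq)).
- rewrite (Rintegral_law mY lawn mq (integrable_normal_prob mq iq)).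
  by rewrite (Rintegral_normal_prob mq iq) normal_variance.
- move=> b; rewrite (Rintegral_law mY lawn (mc b) (integrable_normal_prob (mc b) (ic b))).
  by rewrite (Rintegral_normal_prob (mc b) (ic b)) normal_char_fun.
- move=> _ l e e0.
  have := @normal_prob_itv_gt0 R m s s0 l e e0; rewrite -lawn//.
Qed.

End gaussian_variables.

(** * Gaussian spaces *)

Section sin_quotient.
Context (R : realType).
Implicit Type x : R.

Lemma normr_sin_le x : `|sin x| <= `|x|.
Proof.
wlog x0 : x / 0 < x => [H|].
  have [x0|x0|<-] := ltgtP 0 x; [exact: H| |by rewrite sin0].
  by have := H (- x); rewrite oppr_gt0 sinN !normrN; exact.
have csin : {within `[0, x], continuous (@sin R)}.
  by apply: continuous_subspaceT => y; exact: continuous_sin.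
have [c _] := @MVT R sin cos 0 x x0 (fun y _ => is_derive_sin y) csin.
by rewrite sin0 !subr0 => ->; rewrite normrM ler_piMl// cos_max.
Qed.

(** This is the derivative of sine at 0 along x/(n+1). It approximates an unbounded factor by
    bounded trigonometric functions; x = 0 is separate because the difference quotient excludes a
    zero increment. *)
Lemma cvg_sin_quotient x :
  n.+1%:R * sin (n.+1%:R^-1 * x) @[n --> \oo] --> x.
Proof.
have [->|x0] := eqVneq x 0.
  by under eq_fun do rewrite mulr0 sin0 mulr0; exact: cvg_cst.
have ds : (h^-1 *: ((sin \o shift 0) (h *: 1) - sin 0)) @[h --> 0^'] --> (1 : R).
  have [dv vE] := is_derive_sin (0 : R).
  by rewrite -[X in _ --> X]cos0 -vE; exact: dv.
move/cvgr_dnbhsP : ds => /(_ (fun n => n.+1%:R^-1 * x)) h.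
have {}h : ((n.+1%:R^-1 * x)^-1 *: ((sin \o shift 0) ((n.+1%:R^-1 * x) *: 1) - sin 0))
    @[n --> \oo] --> (1 : R).
  apply: h; split => [n|]; first by rewrite mulf_neq0// invr_neq0// pnatr_eq0.
  rewrite -[X in _ --> X](mul0r x); apply: cvgM; last exact: cvg_cst.
  exact: cvg_harmonic.
rewrite (_ : (fun n => _) = (fun n => x * ((n.+1%:R^-1 * x)^-1 *:
    ((sin \o shift 0) ((n.+1%:R^-1 * x) *: 1) - sin 0)))); last first.
  apply/funext => n; rewrite /GRing.scale/= addr0 mulr1 sin0 subr0 invfM invrK.
  by rewrite mulrA (mulrC _ x^-1) mulrA divff// mul1r.
by rewrite -[X in _ --> X]mulr1; apply: cvgM => //; exact: cvg_cst.
Qed.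

Lemma normr_sin_quotient_le x n : `|n.+1%:R * sin (n.+1%:R^-1 * x)| <= `|x|.
Proof.
rewrite normrM normr_nat; apply: le_trans (ler_wpM2l _ (normr_sin_le _)) _ => //.
by rewrite normrM ger0_norm ?invr_ge0// mulVKf// pnatr_eq0.
Qed.

End sin_quotient.

Section even_derivative.
Context (d : measure_display) (T : measurableType d) (R : realType).
Variable P : probability T R.

Lemma measurable_cos_comp (W : T -> R) : measurable_fun setT W ->
  measurable_fun setT (fun w => cos (W w)).
Proof.
move=> mW; apply: measurableT_comp => //; apply: continuous_measurable_fun.
exact: continuous_cos.
Qed.

Lemma measurable_sin_comp (W : T -> R) : measurable_fun setT W ->
  measurable_fun setT (fun w => sin (W w)).
Proof.
move=> mW; apply: measurableT_comp => //; apply: continuous_measurable_fun.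
exact: continuous_sin.
Qed.

(* The function t |-> E[om cos(W + t Z + b)] is even, so its derivative at 0 vanishes. *)
Lemma even_trig_derivative (om W Z : T -> R) :
  measurable_fun setT W -> measurable_fun setT Z ->
  P.-integrable setT (EFin \o om) ->
  P.-integrable setT (EFin \o (fun w => om w * Z w)) ->
  (forall t b, \int[P]_w (om w * cos (W w + t * Z w + b)) =
               \int[P]_w (om w * cos (W w - t * Z w + b))) ->
  forall b, \int[P]_w (om w * Z w * cos (W w + b)) = 0.
Proof.
move=> mW mZ iom iomZ ev b.
have mom : measurable_fun setT om by apply/measurable_EFinP; case/integrableP: iom.
have msin t : measurable_fun setT (fun w => sin (t * Z w)).
  by apply: measurable_sin_comp; exact: measurable_funM.
have mcos t c : measurable_fun setT (fun w => cos (W w + t * Z w + c)).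
  by apply: measurable_cos_comp; apply: measurable_funD => //;
    apply: measurable_funD => //; exact: measurable_funM.
have mcosN t c : measurable_fun setT (fun w => cos (W w - t * Z w + c)).
  by apply: measurable_cos_comp; apply: measurable_funD => //;
    apply: measurable_funB => //; exact: measurable_funM.
have mcos0 c : measurable_fun setT (fun w => cos (W w + c)).
  by apply: measurable_cos_comp; exact: measurable_funD.
have : \int[P]_w (om w * (n.+1%:R * sin (n.+1%:R^-1 * Z w)) * cos (W w + b))
    @[n --> \oo] --> \int[P]_w (om w * Z w * cos (W w + b)).
  apply: (@dominated_Rcvg _ _ _ _ _ _ (fun w => `|om w * Z w|)).
  - move=> n; apply: measurable_funM => //; apply: measurable_funM => //.
    exact: measurable_funM.
  - move=> w; apply: cvgM; last exact: cvg_cst.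
    by apply: cvgM; [exact: cvg_cst|exact: cvg_sin_quotient].
  - exact: integrable_norm.
  - move=> n w; rewrite normrM (@le_trans _ _ `|om w * (n.+1%:R * sin (n.+1%:R^-1 * Z w))|)//.
      by rewrite ler_piMr// cos_max.
    by rewrite !(normrM (om w)) ler_wpM2l// normr_sin_quotient_le.
have -> : (fun n => \int[P]_w (om w * (n.+1%:R * sin (n.+1%:R^-1 * Z w)) * cos (W w + b)))
    = cst 0.
  apply/funext => n /=; set t := n.+1%:R^-1.
  have i1 : P.-integrable setT (EFin \o (fun w => om w * cos (W w - t * Z w + (b + pi / 2)))).
    by apply: integrable_mul_bounded iom _ (fun w => cos_max _).
  have i2 : P.-integrable setT (EFin \o (fun w => om w * cos (W w + t * Z w + (b + pi / 2)))).
    by apply: integrable_mul_bounded iom _ (fun w => cos_max _).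
  (* With A = W + b + pi/2, cos(A - tZ) - cos(A + tZ) = 2 sin(A) sin(tZ) and sin(A) = cos(W + b);
     evenness makes the difference integrate to 0. *)
  transitivity (\int[P]_w (n.+1%:R / 2 *
     (om w * cos (W w - t * Z w + (b + pi / 2)) - om w * cos (W w + t * Z w + (b + pi / 2))))).
    apply: eq_Rintegral => w _.
    rewrite (_ : W w - t * Z w + (b + pi / 2) = W w + b + pi / 2 - t * Z w); last by ring.
    rewrite (_ : W w + t * Z w + (b + pi / 2) = W w + b + pi / 2 + t * Z w); last by ring.
    by rewrite (cosB (_ + pi / 2)) (cosD (_ + pi / 2)) sinDpihalf; field.
  rewrite RintegralZl//; last exact: (integrableB measurableT i1 i2).
  by rewrite RintegralB// -ev subrr mulr0.
move/cvg_lim => <-//; exact: lim_cst.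
Qed.

End even_derivative.

Section gaussian_spaces.
Context (d : measure_display) (T : measurableType d) (R : realType).
Variable P : probability T R.

(** A Gaussian Hilbert space without completeness: a linear space of centred variables whose
    characteristic functions depend on the variance alone. Closure under combinations turns these
    one-variable clauses into statements on joint laws. *)
Record gaussian_space (H : set (T -> R)) : Prop := GaussianSpace {
  gs_zero : H (fun=> 0);
  gs_lin : forall a b f g, H f -> H g -> H (fun w => a * f w + b * g w);
  gs_meas : forall f, H f -> measurable_fun setT f;
  gs_int : forall f, H f -> P.-integrable setT (EFin \o f);
  gs_mean : forall f, H f -> \int[P]_w f w = 0;
  gs_int2 : forall f, H f -> P.-integrable setT (EFin \o (fun w => f w ^+ 2));
  gs_char : forall f, H f -> forall b,
    \int[P]_w cos (f w + b) = expR (- (\int[P]_w f w ^+ 2) / 2) * cos b;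
  gs_supp : forall f, H f -> 0 < \int[P]_w f w ^+ 2 -> forall l e, 0 < e ->
    (0 < P (f @^-1` `](l - e)%R, (l + e)%R[%classic))%E }.

Variable H : set (T -> R).
Hypothesis gH : gaussian_space H.

Lemma gs_lincomb n (Z : 'I_n -> T -> R) (c : 'I_n -> R) :
  (forall k, H (Z k)) -> H (fun w => \sum_(k < n) c k * Z k w).
Proof.
move=> HZ; elim: n => [|n IH] in Z c HZ *.
  by rewrite (_ : (fun w => _) = fun=> 0); [exact: (gs_zero gH)|apply/funext => w; rewrite big_ord0].
have := gs_lin gH 1 (c ord0)
  (IH (fun k => Z (lift ord0 k)) (fun k => c (lift ord0 k)) (fun k => HZ _)) (HZ ord0).
by congr H; apply/funext => w; rewrite big_ord_recl mul1r addrC.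
Qed.

Lemma gs_intM f g : H f -> H g -> P.-integrable setT (EFin \o (fun w => f w * g w)).
Proof.
move=> Hf Hg.
have i2 := integrableD measurableT (gs_int2 gH Hf) (gs_int2 gH Hg).
apply: le_integrable i2 => //.
  by apply/measurable_EFinP; apply: measurable_funM; exact: (gs_meas gH).
move=> w _ /=; rewrite lee_fin [leRHS]ger0_norm ?addr_ge0 ?sqr_ge0//.
rewrite ler_norml.
have := sqr_ge0 (f w + g w); have := sqr_ge0 (f w - g w).
have := sqr_ge0 (f w); have := sqr_ge0 (g w); lra.
Qed.

Lemma gs_quad a b f g : H f -> H g ->
  \int[P]_w (a * f w + b * g w) ^+ 2 = a ^+ 2 * \int[P]_w f w ^+ 2 +
    (2 * a * b) * \int[P]_w (f w * g w) + b ^+ 2 * \int[P]_w g w ^+ 2.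
Proof.
move=> Hf Hg.
have i1 := integrableZl measurableT (a ^+ 2) (gs_int2 gH Hf).
have i2 := integrableZl measurableT (b ^+ 2) (gs_int2 gH Hg).
have i3 := integrableZl measurableT (2 * a * b) (gs_intM Hf Hg).
transitivity (\int[P]_w (a ^+ 2 * f w ^+ 2 + 2 * a * b * (f w * g w) + b ^+ 2 * g w ^+ 2)).
  by apply: eq_Rintegral => w _; ring.
have i13 := integrableD measurableT i1 i3.
rewrite RintegralD// RintegralD//.
rewrite !RintegralZl//; [exact: (gs_int2 gH)|exact: gs_intM|exact: (gs_int2 gH)].
Qed.

Lemma gs_mul_lincomb n f (Z : 'I_n -> T -> R) (c : 'I_n -> R) :
  H f -> (forall k, H (Z k)) ->
  \int[P]_w (f w * \sum_(k < n) c k * Z k w) = \sum_(k < n) c k * \int[P]_w (f w * Z k w).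
Proof.
move=> Hf HZ; elim: n => [|n IH] in Z c HZ *.
  rewrite big_ord0 -[RHS](Rintegral_probability_cst P).
  by apply: eq_Rintegral => w _; rewrite big_ord0 mulr0.
rewrite big_ord_recl -IH//.
have i1 := integrableZl measurableT (c ord0) (gs_intM Hf (HZ ord0)).
have i2 := gs_intM Hf (gs_lincomb (fun k => c (lift ord0 k)) (fun k => HZ (lift ord0 k))).
rewrite -RintegralZl//; last exact: gs_intM.
rewrite -RintegralD//; apply: eq_Rintegral => w _.
by rewrite big_ord_recl mulrDr mulrCA.
Qed.

Lemma integrable_cos_shift (h : T -> R) b : measurable_fun setT h ->
  P.-integrable setT (EFin \o (fun w => cos (h w + b))).
Proof.
move=> mh; have i1 : P.-integrable setT (EFin \o cst 1).
  exact: finite_measure_integrable_cst.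
have mc : measurable_fun setT (fun w => cos (h w + b)).
  by apply: measurable_cos_comp; apply: measurable_funD.
have := integrable_mul_bounded i1 mc (fun w => cos_max _).
by apply: eq_integrable => // w _ /=; rewrite mul1r.
Qed.

(** Here zero covariance becomes factorization: f + g and f - g both have variance Var f + Var g, so
    the two terms of the product-to-sum formula share one exponential. *)
Lemma gs_cosM f g b b' : H f -> H g -> \int[P]_w (f w * g w) = 0 ->
  \int[P]_w (cos (f w + b) * cos (g w + b')) =
  \int[P]_w cos (f w + b) * \int[P]_w cos (g w + b').
Proof.
move=> Hf Hg fg0.
have HD := gs_lin gH 1 1 Hf Hg; have HB := gs_lin gH 1 (-1) Hf Hg.
have ic h c : H h -> P.-integrable setT (EFin \o (fun w => cos (h w + c))).
  by move=> /(gs_meas gH); exact: integrable_cos_shift.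
transitivity (\int[P]_w (2^-1 * cos ((1 * f w + 1 * g w) + (b + b')) +
                         2^-1 * cos ((1 * f w + -1 * g w) + (b - b')))).
  apply: eq_Rintegral => w _.
  rewrite (_ : 1 * _ + _ + _ = f w + b + (g w + b')); last by ring.
  rewrite (_ : 1 * _ + _ + _ = f w + b - (g w + b')); last by ring.
  by rewrite (cosD (f w + b)) (cosB (f w + b)); field.
have iD := integrableZl measurableT 2^-1 (ic _ (b + b') HD).
have iB := integrableZl measurableT 2^-1 (ic _ (b - b') HB).
rewrite RintegralD// !RintegralZl//; [|exact: ic..].
rewrite !(gs_char gH)// !gs_quad// fg0 !mulr0 !addr0 sqrrN expr1n !mul1r.
set vf := \int[P]_w f w ^+ 2; set vg := \int[P]_w g w ^+ 2.
rewrite (_ : - (vf + vg) / 2 = - vf / 2 + - vg / 2); last by field.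
by rewrite expRD cosD cosB; field.
Qed.

Section independence.
Variables (n : nat) (Z : 'I_n -> T -> R).
Hypothesis HZ : forall k, H (Z k).

Let mZ k : measurable_fun setT (Z k). Proof. exact: (gs_meas gH). Qed.

(** Fourier uniqueness is used twice: first in f, against a fixed cosine of Z, to reach the event f
    in B; then in Z, against that fixed event, to reach all of sigma(Z). *)
Theorem gs_independent f (B : set R) A : H f ->
  (forall k, \int[P]_w (f w * Z k w) = 0) -> measurable B ->
  g_sigma_preimage Z A ->
  measurable A /\ P ((f @^-1` B) `&` A) = (P (f @^-1` B) * P A)%E.
Proof.
move=> Hf fZ mB.
have mf := gs_meas gH Hf.
have mfB : measurable (f @^-1` B) by rewrite -[X in measurable X]setTI; exact: mf.
pose p := fine (P (f @^-1` B)).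
have i1 : P.-integrable setT (EFin \o \1_(f @^-1` B)).
  by apply: integrable_indic.
have icst (r : R) : P.-integrable setT (EFin \o cst r).
  exact: finite_measure_integrable_cst.
pose psi w := \1_(f @^-1` B) w - p.
have ipsi : P.-integrable setT (EFin \o psi).
  exact: (integrableB measurableT i1 (icst p)).
have cosI c b : \int[P]_(w in f @^-1` B) cos (\sum_(k < n) c k * Z k w + b) =
    p * \int[P]_w cos (\sum_(k < n) c k * Z k w + b).
  have Hg := gs_lincomb c HZ; set g := fun w => _ in Hg.
  have fg0 : \int[P]_w (f w * g w) = 0.
    by rewrite gs_mul_lincomb// big1// => k _; rewrite fZ mulr0.
  set ka := \int[P]_w cos _.
  have ig := integrable_cos_shift b (gs_meas gH Hg).
  (* First use: the centred cosine of [g] has zero Fourier transform along [f], since [f] and [g]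
     are uncorrelated. *)
  have nul : trig_null P f (fun w => cos (g w + b) - ka).
    split; first exact: (integrableB measurableT ig (icst ka)).
    move=> s b'.
    have Hsf : H (fun w => s * f w).
      have := gs_lin gH s 0 Hf Hf; congr H; apply/funext => w.
      by rewrite mul0r addr0.
    have is_ := integrable_cos_shift b' (gs_meas gH Hsf).
    under eq_Rintegral do rewrite mulrBl.
    rewrite RintegralB//; last 2 first.
    - apply: integrable_mul_bounded ig _ (fun w => cos_max _).
      by apply: measurable_cos_comp; apply: measurable_funD => //; exact: (gs_meas gH).
    - exact: (integrableZl measurableT ka is_).
    rewrite RintegralZl// gs_cosM ?subrr//.
    under eq_Rintegral do rewrite mulrCA [X in s * X]mulrC.
    have imf := gs_intM Hf Hg.
    by rewrite RintegralZl// fg0 mulr0.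
  have := trig_null_preimage mf nul mB.
  have ig' := integrableS measurableT mfB (@subsetT _ _) ig.
  rewrite RintegralB//; last exact: integrableS (icst ka).
  by rewrite Rintegral_cst// => /subr0_eq ->; rewrite mulrC.
(* Second use: the centred indicator of the event annihilates every cosine of Z. *)
have psi0 c b : \int[P]_w (psi w * cos (\sum_(k < n) c k * Z k w + b)) = 0.
  have Hg := gs_lincomb c HZ.
  have ig := integrable_cos_shift b (gs_meas gH Hg).
  under eq_Rintegral do rewrite mulrBl.
  rewrite RintegralB//; last 2 first.
  - apply: integrable_mul_bounded i1 _ (fun w => cos_max _).
    by apply: measurable_cos_comp; apply: measurable_funD => //; exact: (gs_meas gH).
  - exact: (integrableZl measurableT p ig).
  rewrite RintegralZl// -cosI [X in _ - X]Rintegral_mkcond patch_indic/=.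
  by apply/eqP; rewrite subr_eq0; apply/eqP/eq_Rintegral => w _; rewrite mulrC.
move=> sA; have [mA] := trig_null_sigma mZ ipsi psi0 sA.
move=> h; split => //; move: h.
rewrite RintegralB//; last 2 first.
- exact: integrableS i1.
- exact: integrableS (icst p).
rewrite Rintegral_cst// /Rintegral integral_indic// => /subr0_eq h.
rewrite -[LHS]fineK ?fin_num_measure//; last exact: measurableI.
by rewrite h EFinM !fineK// ?fin_num_measure.
Qed.

(** Without a cross term, the variance of g + t f involves t only through t^2. This supplies the
    evenness that [even_trig_derivative] asks for. *)
Lemma gs_cos_shift f g t b : H f -> H g -> \int[P]_w (f w * g w) = 0 ->
  \int[P]_w cos (g w + t * f w + b) = \int[P]_w cos (g w - t * f w + b).
Proof.
move=> Hf Hg fg0.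
have gf0 : \int[P]_w (g w * f w) = 0.
  by rewrite -[RHS]fg0; apply: eq_Rintegral => w _; rewrite mulrC.
have E s : \int[P]_w cos (g w + s * f w + b) =
    expR (- (\int[P]_w g w ^+ 2 + s ^+ 2 * \int[P]_w f w ^+ 2) / 2) * cos b.
  have Hgf := gs_lin gH 1 s Hg Hf.
  transitivity (\int[P]_w cos ((1 * g w + s * f w) + b)).
    by apply: eq_Rintegral => w _; rewrite mul1r.
  by rewrite (gs_char gH Hgf) gs_quad// gf0 !mulr0 addr0 expr1n mul1r.
rewrite E -[in LHS](sqrrN t) -E; apply: eq_Rintegral => w _.
by rewrite mulNr.
Qed.

Lemma gs_uncorrelated_cos f c b : H f -> (forall k, \int[P]_w (f w * Z k w) = 0) ->
  \int[P]_w (f w * cos (\sum_(k < n) c k * Z k w + b)) = 0.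
Proof.
move=> Hf fZ.
have Hg := gs_lincomb c HZ; set g := fun w => _ in Hg.
have fg0 : \int[P]_w (f w * g w) = 0.
  by rewrite gs_mul_lincomb// big1// => k _; rewrite fZ mulr0.
have i1 : P.-integrable setT (EFin \o cst 1) by exact: finite_measure_integrable_cst.
transitivity (\int[P]_w (cst 1 w * f w * cos (g w + b))).
  by apply: eq_Rintegral => w _; rewrite mul1r.
apply: (even_trig_derivative (gs_meas gH Hg) (gs_meas gH Hf) i1).
  by have := gs_int gH Hf; apply: eq_integrable => // w _ /=; rewrite mul1r.
move=> t b'; under eq_Rintegral do rewrite mul1r.
by under [in RHS]eq_Rintegral do rewrite mul1r; exact: gs_cos_shift.
Qed.

Lemma gs_uncorrelated_sigma f A : H f -> (forall k, \int[P]_w (f w * Z k w) = 0) ->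
  g_sigma_preimage Z A -> \int[P]_(w in A) f w = 0.
Proof.
move=> Hf fZ sA.
by apply: (trig_null_sigma mZ (gs_int gH Hf) _ sA).2 => c b; exact: gs_uncorrelated_cos.
Qed.

(** Handles the cross terms of residuals with affine functions of U. Differentiating in the
    frequency direction [e] produces the unbounded factor; evenness is immediate, as every frequency
    c + t e already gives integral 0. *)
Lemma gs_uncorrelated_mul_sigma f (e : 'I_n -> R) A : H f ->
  (forall k, \int[P]_w (f w * Z k w) = 0) -> g_sigma_preimage Z A ->
  \int[P]_(w in A) (f w * \sum_(k < n) e k * Z k w) = 0.
Proof.
move=> Hf fZ sA.
have He := gs_lincomb e HZ.
have ife := gs_intM Hf He.
apply: (trig_null_sigma mZ ife _ sA).2 => c b.
have Hg := gs_lincomb c HZ.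
apply: (@even_trig_derivative _ _ _ P f _ _ (gs_meas gH Hg) (gs_meas gH He)
  (gs_int gH Hf) ife) => t b'.
have cosE s : \int[P]_w (f w * cos (\sum_(k < n) c k * Z k w +
    s * (\sum_(k < n) e k * Z k w) + b')) = 0.
  rewrite -[RHS](@gs_uncorrelated_cos f (fun k => c k + s * e k) b' Hf fZ).
  apply: eq_Rintegral => w _; congr (_ * cos (_ + _)).
  rewrite mulr_sumr -big_split/=; apply: eq_bigr => k _.
  by rewrite mulrDl mulrA.
rewrite cosE -[LHS](cosE (- t)); apply: eq_Rintegral => w _.
by rewrite mulNr.
Qed.

Lemma gs_sqr_cos f c b : H f -> (forall k, \int[P]_w (f w * Z k w) = 0) ->
  \int[P]_w (f w ^+ 2 * cos (\sum_(k < n) c k * Z k w + b)) =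
  \int[P]_w f w ^+ 2 * \int[P]_w cos (\sum_(k < n) c k * Z k w + b).
Proof.
move=> Hf fZ; have mf := gs_meas gH Hf.
have Hg := gs_lincomb c HZ; set g := fun w => _ in Hg.
have fg0 : \int[P]_w (f w * g w) = 0.
  by rewrite gs_mul_lincomb// big1// => k _; rewrite fZ mulr0.
have mg := gs_meas gH Hg.
pose q k w := (k.+1%:R * sin (k.+1%:R^-1 * f w)) ^+ 2.
have mq k : measurable_fun setT (q k).
  apply: measurable_funX; apply: measurable_funM => //.
  by apply: measurable_sin_comp; exact: measurable_funM.
have qf k w : `|q k w| <= f w ^+ 2.
  rewrite normrX -[leRHS]real_normK ?num_real//.
  by apply: lerXn2r; rewrite ?nnegrE// normr_sin_quotient_le.
have cq w : q k w @[k --> \oo] --> f w ^+ 2.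
  rewrite expr2 /q; under eq_fun do rewrite expr2.
  by apply: cvgM; exact: cvg_sin_quotient.
have mcos : measurable_fun setT (fun w => cos (g w + b)).
  by apply: measurable_cos_comp; exact: measurable_funD.
have l1 : \int[P]_w (q k w * cos (g w + b)) @[k --> \oo] -->
    \int[P]_w (f w ^+ 2 * cos (g w + b)).
  apply: (@dominated_Rcvg _ _ _ _ _ _ (fun w => f w ^+ 2)).
  - by move=> k; exact: measurable_funM.
  - by move=> w; apply: cvgM; [exact: cq|exact: cvg_cst].
  - exact: (gs_int2 gH).
  - move=> k w; rewrite normrM (le_trans _ (qf k w))// ler_piMr//.
    exact: cos_max.
have l2 : \int[P]_w (q k w) * \int[P]_w cos (g w + b) @[k --> \oo] -->
    \int[P]_w f w ^+ 2 * \int[P]_w cos (g w + b).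
  apply: cvgM; last exact: cvg_cst.
  by apply: (@dominated_Rcvg _ _ _ _ _ _ (fun w => f w ^+ 2)) => //; exact: (gs_int2 gH).
suff E : (fun k => \int[P]_w (q k w * cos (g w + b))) =
    (fun k => \int[P]_w (q k w) * \int[P]_w cos (g w + b)).
  by rewrite E in l1; exact: (cvg_unique _ l1 l2).
(* By sin^2 x = (1 - cos 2x)/2, the approximant [q k] of f^2 is r - r cos(t f), to which [gs_cosM]
   applies. *)
apply/funext => k; pose r : R := k.+1%:R ^+ 2 / 2; pose t : R := 2 * k.+1%:R^-1.
have Htf : H (fun w => t * f w).
  have := gs_lin gH t 0 Hf Hf; congr H; apply/funext => w.
  by rewrite mul0r addr0.
have qE w : q k w = r - r * cos (t * f w + 0).
  rewrite addr0 /q exprMn (_ : t * f w = (k.+1%:R^-1 * f w) *+ 2); last first.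
    by rewrite -mulr_natl /t mulrA.
  by rewrite cos_mulr2n sin2cos2 /r -mulr_natl; field.
have tfg0 : \int[P]_w (t * f w * g w) = 0.
  under eq_Rintegral do rewrite -mulrA.
  by rewrite RintegralZl ?fg0 ?mulr0//; exact: gs_intM.
have ig := integrable_cos_shift b mg.
have icst : P.-integrable setT (EFin \o cst r) by exact: finite_measure_integrable_cst.
have itf := integrable_cos_shift 0 (gs_meas gH Htf).
have itg : P.-integrable setT (EFin \o (fun w => cos (t * f w + 0) * cos (g w + b))).
  exact: integrable_mul_bounded itf mcos (fun w => cos_max _).
transitivity (\int[P]_w (r * cos (g w + b) - r * (cos (t * f w + 0) * cos (g w + b)))).
  by apply: eq_Rintegral => w _; rewrite qE mulrBl mulrA.
under [in RHS]eq_Rintegral do rewrite qE.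
have jtf := integrableZl measurableT r itf.
have jg := integrableZl measurableT r ig.
have jtg := integrableZl measurableT r itg.
rewrite !RintegralB// Rintegral_probability_cst !RintegralZl//.
by rewrite gs_cosM// mulrBl mulrA.
Qed.

(** Polarization, 4 f1 f2 = (f1 + f2)^2 - (f1 - f2)^2: sum and difference stay in [H] and
    uncorrelated with Z, so the result on squares suffices. *)
Lemma gs_mul_sigma f1 f2 A : H f1 -> H f2 ->
  (forall k, \int[P]_w (f1 w * Z k w) = 0) ->
  (forall k, \int[P]_w (f2 w * Z k w) = 0) -> g_sigma_preimage Z A ->
  \int[P]_(w in A) (f1 w * f2 w - \int[P]_w' (f1 w' * f2 w')) = 0.
Proof.
move=> Hf1 Hf2 fZ1 fZ2 sA; set ka := \int[P]_w _.
have i12 := gs_intM Hf1 Hf2.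
have icst : P.-integrable setT (EFin \o cst ka) by exact: finite_measure_integrable_cst.
have ipsi := integrableB measurableT i12 icst.
apply: (trig_null_sigma mZ ipsi _ sA).2 => c b.
have Hg := gs_lincomb c HZ; have mg := gs_meas gH Hg.
have ig := integrable_cos_shift b mg.
have mcos : measurable_fun setT (fun w => cos (\sum_(k < n) c k * Z k w + b)).
  by apply: measurable_cos_comp; exact: measurable_funD.
have HS s := gs_lin gH 1 s Hf1 Hf2.
have ZS s k : \int[P]_w ((1 * f1 w + s * f2 w) * Z k w) = 0.
  have i1 := integrableZl measurableT 1 (gs_intM Hf1 (HZ k)).
  have i2 := integrableZl measurableT s (gs_intM Hf2 (HZ k)).
  under eq_Rintegral do rewrite mulrDl -!mulrA.
  rewrite RintegralD// !RintegralZl//; [|exact: gs_intM..].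
  by rewrite fZ1 fZ2 !mulr0 addr0.
have sq s := @gs_sqr_cos _ c b (HS s) (ZS s).
have isq s := integrable_mul_bounded (gs_int2 gH (HS s)) mcos (fun w => cos_max _).
under eq_Rintegral do rewrite mulrBl.
rewrite RintegralB//; last 2 first.
- exact: integrable_mul_bounded i12 mcos (fun w => cos_max _).
- exact: (integrableZl measurableT ka ig).
apply/eqP; rewrite subr_eq0 RintegralZl//; apply/eqP.
transitivity (\int[P]_w (4^-1 * ((1 * f1 w + 1 * f2 w) ^+ 2 * cos (\sum_(k < n) c k * Z k w + b))
   - 4^-1 * ((1 * f1 w + -1 * f2 w) ^+ 2 * cos (\sum_(k < n) c k * Z k w + b)))).
  by apply: eq_Rintegral => w _; field.
rewrite RintegralB//; last 2 first.
- exact: (integrableZl measurableT 4^-1 (isq 1)).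
- exact: (integrableZl measurableT 4^-1 (isq (-1))).
rewrite !RintegralZl// !sq !gs_quad// -/ka.
by set I1 := \int[P]_w f1 w ^+ 2; set I2 := \int[P]_w f2 w ^+ 2; field.
Qed.

End independence.
End gaussian_spaces.

(** * Support of a nondegenerate Gaussian vector *)

Section gaussian_support.
Context (d : measure_display) (T : measurableType d) (R : realType).
Variable P : probability T R.

Lemma countable_cover_null (I : countType) (S : I -> set T) (E : set T) :
  (forall i, measurable (S i) /\ P (S i) = 0%E) -> measurable E ->
  E `<=` \bigcup_i S i -> P E = 0%E.
Proof.
move=> S0 mE ES; apply: measure_negligible => //.
pose F n := oapp S set0 (@unpickle I n).
apply: (@negligibleS _ _ _ P (\bigcup_n F n)).
  move=> w /ES[i _ Siw]; exists (pickle i) => //.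
  by rewrite /F pickleK.
apply: negligible_bigcup => n; rewrite /F; case: unpickle => [i|]/=.
  by exists (S i); split => //; [exact: (S0 i).1|exact: (S0 i).2].
exact: negligible_set0.
Qed.

Definition box n (Z : 'I_n -> T -> R) (v : 'I_n -> R) (e : R) : set T :=
  [set w | forall k, `|Z k w - v k| < e].

Lemma boxE n (Z : 'I_n -> T -> R) v e :
  box Z v e = \big[setI/setT]_(k < n) (Z k @^-1` ball (v k) e).
Proof.
apply/seteqP; split => w /=.
  move=> h; apply: (@big_ind _ (fun S : set T => S w)) => // k _.
  by rewrite -ball_normE /= distrC.
by move=> + k; rewrite (bigD1 k)//= => -[]; rewrite -ball_normE /= distrC.
Qed.

Lemma box_sigma n (Z : 'I_n -> T -> R) v e : g_sigma_preimage Z (box Z v e).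
Proof.
rewrite boxE; apply: (@bigsetI_measurable _ (g_sigma_algebraType
  (\big[setU/set0]_(i < n) preimage_set_system setT (Z i) measurable))) => k _.
apply: sub_sigma_algebra; apply/bigsetU_exists; exists k; exists (ball (v k) e).
  exact: measurable_ball.
by rewrite setTI.
Qed.

Lemma measurable_box n (Z : 'I_n -> T -> R) v e :
  (forall k, measurable_fun setT (Z k)) -> measurable (box Z v e).
Proof.
move=> mZ; rewrite boxE; apply: bigsetI_measurable => k _.
by rewrite -[X in measurable X]setTI; apply: mZ => //; exact: measurable_ball.
Qed.

Variable H : set (T -> R).
Hypothesis gH : gaussian_space P H.

Lemma gs_var_eq0 f g : H f -> H g -> \int[P]_w f w ^+ 2 = 0 ->
  \int[P]_w (f w * g w) = 0.
Proof.
move=> Hf Hg f0.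
set q := \int[P]_w (f w * g w); set z := \int[P]_w g w ^+ 2.
have z0 : 0 <= z by apply: Rintegral_ge0 => w _; rewrite sqr_ge0.
(* The coefficients make the quadratic form equal to -q^2 (z + 2) when Var f = 0, which forces q =
   0. *)
have : 0 <= \int[P]_w ((z + 1) * f w + - q * g w) ^+ 2.
  by apply: Rintegral_ge0 => w _; rewrite sqr_ge0.
rewrite (gs_quad gH)// f0 -/q -/z => h.
have h2 : q ^+ 2 * (z + 2) <= 0 by lra.
apply/eqP; rewrite -sqrf_eq0 eq_le sqr_ge0 andbT.
by rewrite -(@pmulr_lle0 _ (z + 2))//; lra.
Qed.

Section full_support.
Variables (n : nat) (Z : 'I_n -> T -> R).
Hypothesis HZ : forall k, H (Z k).
Hypothesis covZ : (\matrix_(a, b) \int[P]_w (Z a w * Z b w)) \in unitmx.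

(* Moving the centre of a box by h amounts to translating the coordinate L = (M^-1 h).Z, which is
   independent of its complement Z - L h / Var L and charges every interval. *)
Lemma gs_box_null_shift (v0 v : 'I_n -> R) e : 0 < e ->
  P (box Z v0 e) = 0%E -> P (box Z v (e / 4)) = 0%E.
Proof.
move=> e0 P0.
have mZ k := gs_meas gH (HZ k).
pose M : 'M[R]_n := \matrix_(a, b) \int[P]_w (Z a w * Z b w).
have uM : M \in unitmx := covZ.
pose h : 'cV[R]_n := \col_k (v0 k - v k).
have [h0|h0] := eqVneq h 0.
  have v0v k : v0 k = v k.
    by apply/subr0_eq; have := congr1 (fun A : 'cV_n => A k 0) h0; rewrite !mxE.
  apply/eqP; rewrite -measure_le0 -P0; apply: le_measure; rewrite ?inE.
  - exact: measurable_box.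
  - exact: measurable_box.
  - by move=> w /= bw k; rewrite v0v (lt_le_trans (bw k))//; lra.
(* This choice gives Cov(L, Z_k) = h_k, so raising L by Var L with its uncorrelated complement held
   fixed moves Z by exactly [h]. *)
pose la := invmx M *m h.
have Mla : M *m la = h by rewrite mulmxA mulmxV// mul1mx.
have HL := gs_lincomb gH (fun k => la k 0) HZ.
set L := fun w => _ in HL.
have LZ k : \int[P]_w (L w * Z k w) = h k 0.
  rewrite -Mla mxE -[RHS]/(\sum_j _).
  transitivity (\int[P]_w (Z k w * L w)).
    by apply: eq_Rintegral => w _; rewrite mulrC.
  rewrite (gs_mul_lincomb gH)//; apply: eq_bigr => j _.
  by rewrite [M k j]mxE mulrC.
pose V := \int[P]_w L w ^+ 2.
(* With zero variance L would be uncorrelated with every Z_k, that is h = 0, the case already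
   settled. *)
have V0 : 0 < V.
  rewrite lt_neqAle Rintegral_ge0 ?andbT; last by move=> w _; rewrite sqr_ge0.
  apply/eqP => V0; move/eqP: h0; apply; apply/colP => k; rewrite -LZ [RHS]mxE.
  by rewrite gs_var_eq0.
pose Zp k w := 1 * Z k w + - (h k 0 / V) * L w.
have HZp k : H (Zp k) by exact: (gs_lin gH).
have LZp k : \int[P]_w (L w * Zp k w) = 0.
  transitivity (\int[P]_w (L w * Z k w - h k 0 / V * L w ^+ 2)).
    by apply: eq_Rintegral => w _; rewrite /Zp; ring.
  have i1 := gs_intM gH HL (HZ k).
  have i2 := gs_int2 gH HL.
  have i3 := integrableZl measurableT (h k 0 / V) i2.
  rewrite RintegralB// RintegralZl// LZ -/V divfK ?subrr//.
  by rewrite gt_eqF.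
pose K := 1 + \sum_(k < n) `|h k 0|.
have K1 : 1 <= K by rewrite lerDl sumr_ge0.
have hK k : `|h k 0| <= K.
  by rewrite /K (bigD1 k)//= addrCA lerDl addr_ge0// sumr_ge0.
(* The width of the slices in L: inside one, the contribution h_k L / V varies from its centre by at
   most e/4 for every k. *)
pose dl := e * V / (4 * K).
have dl0 : 0 < dl by rewrite divr_gt0 ?mulr_gt0//; lra.
have small k x : `|x| < dl -> `|h k 0 / V * x| <= e / 4.
  move=> xd; rewrite normrM.
  apply: (@le_trans _ _ (K / V * dl)).
    apply: ler_pM => //; last exact: ltW.
    by rewrite normf_div (ger0_norm (ltW V0)) ler_pM2r ?invr_gt0.
  rewrite /dl le_eqVlt; apply/orP; left; apply/eqP; field.
  by rewrite !gt_eqF//; lra.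
have slice (q : rat) : let S := box Z v (e / 4) `&`
    L @^-1` `](ratr q - dl)%R, (ratr q + dl)%R[%classic in
    measurable S /\ P S = 0%E.
  set l : R := ratr q.
  have mL l' : measurable (L @^-1` `](l' - dl)%R, (l' + dl)%R[%classic).
    by rewrite -[X in measurable X]setTI; apply: (gs_meas gH HL).
  have mS : measurable (box Z v (e / 4) `&`
      L @^-1` `](l - dl)%R, (l + dl)%R[%classic).
    by apply: measurableI => //; exact: measurable_box.
  split => //.
  pose vp k := v k - h k 0 / V * l.
  have [mA indep] := gs_independent gH HZp HL LZp
    (measurable_itv `](l + V - dl), (l + V + dl)[) (@box_sigma _ Zp vp (e / 2)).
  (* Where L is near l + V, the box of [Zp] lies in the null box at [v0], since e/2 + e/4 < e.
     Independence and the positive mass of that range of L force the box of [Zp] to be null; it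
     contains the slice near l, since e/4 + e/4 = e/2. *)
  have A0 : P (box Zp vp (e / 2)) = 0%E.
    have LA0 : P (L @^-1` `](l + V - dl)%R, (l + V + dl)%R[%classic `&` box Zp vp (e / 2)) = 0%E.
      apply/eqP; rewrite -measure_le0 -P0; apply: le_measure; rewrite ?inE.
      - exact: measurableI.
      - exact: measurable_box.
      - move=> w [/= + bw] k; rewrite in_itv/= => Lw.
        have v0E : v0 k = v k + h k 0 by rewrite mxE; ring.
        rewrite (_ : Z k w - v0 k = (Zp k w - vp k) + h k 0 / V * (L w - l - V)); last first.
          by rewrite /Zp /vp v0E; field; rewrite gt_eqF.
        rewrite (le_lt_trans (ler_normD _ _))//.
        have sm : `|L w - l - V| < dl by rewrite ltr_norml; lra.
        have := small k _ sm; have := bw k; lra.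
    move: indep; rewrite LA0 => /esym/eqP; rewrite mule_eq0 => /orP[|/eqP//].
    by rewrite gt_eqF// (gs_supp gH).
  apply/eqP; rewrite -measure_le0 -A0; apply: le_measure; rewrite ?inE//.
  move=> w [/= bw]; rewrite in_itv/= => Lw k.
  rewrite (_ : Zp k w - vp k = (Z k w - v k) + - (h k 0 / V * (L w - l))); last first.
    by rewrite /Zp /vp; ring.
  rewrite (le_lt_trans (ler_normD _ _))// normrN.
  have sm : `|L w - l| < dl by rewrite ltr_norml; lra.
  have := small k _ sm; have := bw k; lra.
apply: (countable_cover_null slice); first exact: measurable_box.
move=> w bw; have /rat_in_itvoo[q qL] : L w - dl < L w + dl by lra.
exists q => //; split => //=; rewrite in_itv/=.
by move: qL; rewrite in_itv/=; lra.
Qed.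

(** One null box would make all boxes of a quarter of its radius null, and countably many of those,
    with rational centres, cover the whole space. *)
Theorem gs_box_gt0 v e : 0 < e -> (0 < P (box Z v e))%E.
Proof.
move=> e0; rewrite lt_neqAle measure_ge0 andbT eq_sym; apply/negP => /eqP P0.
have mZ k := gs_meas gH (HZ k).
have : P setT = 0%E.
  apply: (@countable_cover_null {ffun 'I_n -> rat} (fun q => box Z (ratr \o q) (e / 4))) => //.
    move=> q; split; first exact: measurable_box.
    exact: gs_box_null_shift e0 P0.
  move=> w _.
  have /choice[q qP] : forall k, exists q : rat, `|Z k w - ratr q| < e / 4.
    move=> k; have /rat_in_itvoo[q] : Z k w - e / 4 < Z k w + e / 4 by lra.
    by rewrite in_itv/= => qP; exists q; rewrite ltr_norml; lra.
  by exists (finfun q) => // k /=; rewrite ffunE.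
by rewrite probability_setT => /eqP; rewrite onee_eq0.
Qed.

End full_support.
End gaussian_support.

(** * Conditional means *)

Section gaussian_span.
Context (d : measure_display) (T : measurableType d) (R : realType).
Variable P : probability T R.

Definition centered (Y : T -> R) (w : T) : R := Y w - \int[P]_w' Y w'.

Definition centered_span (I : Type) (Y : I -> {RV P >-> R}) : set (T -> R) :=
  [set f | exists n (i : 'I_n -> I) (c : 'I_n -> R),
    f = fun w => \sum_(k < n) c k * centered (Y (i k)) w].

Lemma fine_covariance (X Y : T -> R) :
  fine (covariance P X Y) = \int[P]_w (centered X w * centered Y w).
Proof. by rewrite covariance.unlock !expectation.unlock. Qed.

Lemma jointly_gaussian_integrable (I : Type) (Y : I -> {RV P >-> R}) i :
  jointly_gaussian Y -> P.-integrable setT (EFin \o (Y i)).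
Proof.
move=> /(_ 1%N (fun=> i) (fun=> 1)) gY.
have {}gY : gaussian P (Y i).
  by move: gY; congr gaussian; apply/funext => w; rewrite big_ord1 mul1r.
by have [m [v []]] := gaussianP (measurable_funPT (Y i)) gY.
Qed.

Lemma jointly_gaussian_space (I : Type) (Y : I -> {RV P >-> R}) :
  jointly_gaussian Y -> gaussian_space P (centered_span Y).
Proof.
move=> gY.
have iY i : P.-integrable setT (EFin \o (Y i)) by exact: jointly_gaussian_integrable.
have spec f : centered_span Y f -> exists Y' v, gaussian_spec P Y' (\int[P]_w Y' w) v /\
    measurable_fun setT Y' /\ f = centered Y'.
  move=> [n [i [c ->]]].
  pose Y' w := \sum_(k < n) c k * Y (i k) w.
  have mY' : measurable_fun setT Y' by exact: measurable_lin_comb.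
  have [m [v sp]] := gaussianP mY' (gY n i c).
  exists Y', v; split; first by rewrite (gspec_mean sp).
  split => //; apply/funext => w; rewrite /centered.
  have -> : \int[P]_w' Y' w' = \sum_(k < n) c k * \int[P]_w' Y (i k) w'.
    rewrite /Y'; clear -iY; elim: n => [|n IH] in i c *.
      rewrite big_ord0 -[RHS](Rintegral_probability_cst P).
      by apply: eq_Rintegral => w _; rewrite big_ord0.
    rewrite big_ord_recl -IH -RintegralZl// -RintegralD//.
    - by apply: eq_Rintegral => w _; rewrite big_ord_recl.
    - exact: (integrableZl measurableT (c ord0) (iY (i ord0))).
    - have -> : EFin \o (fun w => \sum_(k < n) c (lift ord0 k) * Y (i (lift ord0 k)) w) =
          (fun w => \sum_(k <- index_enum 'I_n) (c (lift ord0 k))%:E * (Y (i (lift ord0 k)) w)%:E)%E.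
        by apply/funext => w /=; rewrite -sumEFin.
      apply: integrable_sum => // k _.
      exact: (integrableZl measurableT (c (lift ord0 k)) (iY (i (lift ord0 k)))).
  by rewrite -sumrB; apply: eq_bigr => k _; rewrite mulrBr.
have icst (r : R) : P.-integrable setT (EFin \o cst r).
  exact: finite_measure_integrable_cst.
split.
(* Zero is the empty combination; the index map eliminates ['I_0] because [I] may be empty. *)
- exists 0%N, (fun k : 'I_0 => match k with Ordinal _ k0 => False_rect I (notF k0) end), (fun=> 0).
  by apply/funext => w; rewrite big_ord0.
- move=> a b _ _ [n1 [i1 [c1 ->]]] [n2 [i2 [c2 ->]]].
  exists (n1 + n2)%N, (fun k => match fintype.split k with inl k => i1 k | inr k => i2 k end),
    (fun k => match fintype.split k with inl k => a * c1 k | inr k => b * c2 k end).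
  apply/funext => w; rewrite big_split_ord/= !mulr_sumr.
  congr (_ + _); apply: eq_bigr => k _.
    case: splitP => j /= jk; last by have := ltn_ord k; rewrite jk ltnNge leq_addr.
    by rewrite mulrA; congr (_ * c1 _ * centered (Y (i1 _)) w); exact: val_inj.
  case: splitP => j /= jk; first by have := ltn_ord j; rewrite -jk ltnNge leq_addr.
  by rewrite mulrA; congr (_ * c2 _ * centered (Y (i2 _)) w); apply: val_inj => /=; exact: (addnI jk).
- by move=> _ /spec[Y' [v [_ [mY' ->]]]]; exact: measurable_funB.
- move=> _ /spec[Y' [v [sp [mY' ->]]]].
  exact: (integrableB measurableT (gspec_int sp) (icst _)).
- move=> _ /spec[Y' [v [sp [mY' ->]]]].
  have iY' := gspec_int sp.
  rewrite RintegralB//; last exact: icst.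
  by rewrite Rintegral_probability_cst subrr.
- by move=> _ /spec[Y' [v [sp [mY' ->]]]]; exact: gspec_int2 sp.
- by move=> _ /spec[Y' [v [sp [mY' ->]]]] b; rewrite (gspec_var sp) (gspec_char sp).
- move=> _ /spec[Y' [v [sp [mY' ->]]]]; rewrite (gspec_var sp) => v0 l e e0.
  have := gspec_supp sp v0 (l + \int[P]_w Y' w) e0.
  congr (_ < P _)%E; apply/seteqP; split => w /=; rewrite !in_itv/= /centered; lra.
Qed.

Lemma centered_span_mem (I : Type) (Y : I -> {RV P >-> R}) i :
  centered_span Y (centered (Y i)).
Proof.
exists 1%N, (fun=> i), (fun=> 1); apply/funext => w.
by rewrite big_ord1 mul1r.
Qed.

End gaussian_span.

Section conditional_mean.
Context (d : measure_display) (T : measurableType d) (R : realType).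
Variables (P : probability T R) (N : nat) (U : 'I_N -> {RV P >-> R}).

(** Conditioning is on [U], while a Gaussian space holds only centred variables; translation by the
    means relates the two. *)
Lemma centered_sigma A : g_sigma_preimage U A ->
  g_sigma_preimage (fun a => centered P (U a)) A.
Proof.
apply: smallest_sub; first exact: smallest_sigma_algebra.
move=> B /bigsetU_exists[a [C mC <-]]; apply: sub_sigma_algebra.
apply/bigsetU_exists; exists a; exists ((fun r => r + \int[P]_w U a w) @^-1` C).
  by rewrite -[X in measurable X]setTI; apply: measurable_funD.
by congr (_ `&` _); apply/seteqP; split => w /=; rewrite /centered subrK.
Qed.

Lemma is_cond_meanP (O : T -> R) (phi : 'cV[R]_N -> R) :
  continuous phi -> P.-integrable setT (EFin \o O) ->
  P.-integrable setT (EFin \o (fun w => phi (\col_a U a w))) ->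
  (forall A, g_sigma_preimage U A ->
    measurable A /\ \int[P]_(w in A) (O w - phi (\col_a U a w)) = 0) ->
  is_cond_mean U O phi.
Proof.
move=> cphi iO iphi h; split => // A /h[mA].
have iOA := integrableS measurableT mA (@subsetT _ _) iO.
have ipA := integrableS measurableT mA (@subsetT _ _) iphi.
rewrite RintegralB// => /subr0_eq E.
by rewrite -[LHS]fineK ?integrable_fin_num// -[RHS]fineK ?integrable_fin_num//; congr EFin.
Qed.

(** If one version exceeds the other at a point, continuity keeps a positive margin on a box around
    it. That box is an event of sigma(U) of positive probability, on which the two integrals would
    differ. *)
Lemma is_cond_mean_unique (O : T -> R) (phi1 phi2 : 'cV[R]_N -> R) :
  (forall v e, 0 < e -> (0 < P (box U v e))%E) ->
  is_cond_mean U O phi1 -> is_cond_mean U O phi2 -> phi1 = phi2.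
Proof.
move=> supp.
have main (p1 p2 : 'cV[R]_N -> R) : is_cond_mean U O p1 -> is_cond_mean U O p2 ->
    forall v, p1 v <= p2 v.
  move=> [c1 iO i1 E1] [c2 _ i2 E2] v; rewrite leNgt; apply/negP => v12.
  pose eta := (p1 v - p2 v) / 2.
  have eta0 : 0 < eta by rewrite divr_gt0//; lra.
  have cdel : {for v, continuous (fun u => p1 u - p2 u)}.
    by apply: continuousB; [exact: c1|exact: c2].
  have : \forall u \near v, `|(p1 v - p2 v) - (p1 u - p2 u)| < eta.
    by move: cdel => /cvgrPdist_lt; apply.
  move=> /nbhs_ballP[e /= e0 he].
  set A := box U (fun a => v a 0) e.
  have sA : g_sigma_preimage U A by exact: box_sigma.
  have mA : measurable A by exact: measurable_box.
  have j1 := integrableS measurableT mA (@subsetT _ _) i1.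
  have j2 := integrableS measurableT mA (@subsetT _ _) i2.
  have D0 : \int[P]_(w in A) (p1 (\col_a U a w) - p2 (\col_a U a w)) = 0.
    by rewrite RintegralB// /Rintegral -E1// -E2// subrr.
  have PA := supp (fun a => v a 0) e e0.
  have pA : 0 < fine (P A).
    by rewrite fine_gt0// PA ltey_eq fin_num_measure.
  have : eta * fine (P A) <= 0.
    rewrite -D0 -Rintegral_cst//; apply: le_Rintegral => //.
    - have icst : P.-integrable setT (EFin \o cst eta).
      exact: finite_measure_integrable_cst.
    exact: integrableS icst.
    - exact: (integrableB mA j1 j2).
    - move=> w Aw; have := he (\col_a U a w); rewrite ltr_norml.
      move=> /(_ _)/andP[|_]; last by rewrite /eta; lra.
      by split => // i j; rewrite /ball/= mxE ord1 distrC; exact: Aw.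
  by rewrite leNgt mulr_gt0.
move=> h1 h2; apply/funext => v; apply/eqP.
by rewrite eq_le (main _ _ h1 h2) (main _ _ h2 h1).
Qed.

End conditional_mean.

Section continuous_col.
Context (R : realType) (N : nat).
Implicit Types f h : 'cV[R]_N -> R.

Lemma continuous_colD f h : continuous f -> continuous h ->
  continuous (fun V => f V + h V).
Proof. by move=> cf ch V; have := @continuousD _ _ _ f h V (cf V) (ch V); exact. Qed.

Lemma continuous_colM f h : continuous f -> continuous h ->
  continuous (fun V => f V * h V).
Proof. by move=> cf ch V; exact: (@continuousM _ _ f h V (cf V) (ch V)). Qed.

Lemma continuous_col_affine r (c m : 'I_N -> R) :
  continuous (fun V : 'cV[R]_N => r + \sum_(a < N) c a * (V a 0 - m a)).
Proof.
apply: continuous_colD; first exact: cst_continuous.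
apply: continuous_big => [|a _]; first exact: add_continuous.
apply: continuous_colM; first exact: cst_continuous.
by apply: continuous_colD; [exact: coord_continuous|exact: cst_continuous].
Qed.

End continuous_col.

(** * The conditional covariance formula *)

Unset Implicit Arguments.

Theorem lemma2 (R : realType) (d : measure_display) (T : measurableType d)
    (P : probability T R) (X : Type) (u : X -> {RV P >-> R})
    (ainv : X -> X -> R) (N : nat) (g : 'I_N -> gen_fun X R)
    (U : 'I_N -> {RV P >-> R}) (M : 'M[R]_N)
    (u_gaussian : jointly_gaussian u)
    (u_cov : forall x y, covariance P (u x) (u y) = (ainv x y)%:E)
    (U_def : forall a, {ae P, forall w,
       pdom (g a) (fun x => u x w) /\
       U a w = pairing (g a) (fun x => u x w)})
    (uU_gaussian : jointly_gaussian (family_sum u U))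
    (uU_cov : forall x a,
       pdom (g a) (fun y => ainv x y) /\
       covariance P (u x) (U a) = (pairing (g a) (fun y => ainv x y))%:E)
    (M_def : forall b a,
       pdom (g b) (fun x => pairing (g a) (fun y => ainv x y)) /\
       M b a = pairing (g b) (fun x => pairing (g a) (fun y => ainv x y)))
    (U_cov : forall b a, covariance P (U b) (U a) = (M b a)%:E)
    (M_inv : M \in unitmx) (x y : X) :
  [/\ cond_mean_exists U (u x), cond_mean_exists U (u y),
      cond_mean_exists U (fun w => u x w * u y w) &
      forall V : 'cV[R]_N,
        cond_cov U (u x) (u y) V =
        fine (covariance P (u x) (u y)) -
        \sum_(a < N) regression_coef ainv g M a x *
                     pairing (g a) (fun z => ainv z y)].
Proof.
pose H := centered_span (family_sum u U).
have gH : gaussian_space P H := jointly_gaussian_space uU_gaussian.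
pose uc z := centered P (u z); pose Z a := centered P (U a).
have Huc z : H (uc z) := centered_span_mem (family_sum u U) (inl z).
have HZ a : H (Z a) := centered_span_mem (family_sum u U) (inr a).
have iu z : P.-integrable setT (EFin \o (u z)).
  exact: (jointly_gaussian_integrable (inl z) uU_gaussian).
have covZ b a : \int[P]_w (Z b w * Z a w) = M b a.
  by rewrite -fine_covariance U_cov.
have covuZ z a : \int[P]_w (uc z w * Z a w) = pairing (g a) (fun t => ainv z t).
  by rewrite -fine_covariance (uU_cov z a).2.
have supp v e : 0 < e -> (0 < P (box U v e))%E.
  move=> e0; rewrite (_ : box U v e = box Z (fun a => v a - \int[P]_w U a w) e).
    apply: (gs_box_gt0 gH HZ) => //.
    by rewrite (_ : \matrix_(a, b) _ = M)//; apply/matrixP => a b; rewrite mxE covZ.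
  by apply/seteqP; split => w /= h a; have := h a; rewrite /Z /centered opprB addrA subrK.
have sZ A : g_sigma_preimage U A -> g_sigma_preimage Z A := @centered_sigma _ _ _ P N U A.
pose c z a := regression_coef ainv g M a z.
pose xi z w := 1 * uc z w + (-1) * \sum_(a < N) c z a * Z a w.
have Hxi z : H (xi z) by apply: (gs_lin gH) => //; exact: (gs_lincomb gH).
have xiZ z k : \int[P]_w (xi z w * Z k w) = 0.
  have HS := gs_lincomb gH (c z) HZ.
  have i1 := gs_intM gH (Huc z) (HZ k).
  have i2 := gs_intM gH HS (HZ k).
  transitivity (\int[P]_w (uc z w * Z k w - (\sum_(a < N) c z a * Z a w) * Z k w)).
    by apply: eq_Rintegral => w _; rewrite /xi; ring.
  rewrite RintegralB// covuZ; apply/eqP; rewrite subr_eq0; apply/eqP.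
  transitivity (\int[P]_w (Z k w * \sum_(a < N) c z a * Z a w)); last first.
    by apply: eq_Rintegral => w _; rewrite mulrC.
  rewrite (gs_mul_lincomb gH)//.
  (* [A] holds the covariances of u(z) with the U_b and [c z] is the row A M^-1; orthogonality of
     the residual is the normal equation A M^-1 M = A. *)
  pose A : 'rV[R]_N := \row_b pairing (g b) (fun t => ainv z t).
  have AM : A *m invmx M *m M = A by rewrite mulmxKV.
  have := congr1 (fun B : 'rV_N => B 0 k) AM; rewrite [in RHS]mxE => <-.
  rewrite mxE; apply: eq_bigr => a _; rewrite mxE; congr (_ * _).
    by apply: eq_bigr => b _; rewrite mxE.
  by rewrite -covZ; apply: eq_Rintegral => w _; rewrite mulrC.
pose ka := \int[P]_w (xi x w * xi y w).
have kaE : ka = fine (covariance P (u x) (u y)) -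
    \sum_(a < N) c x a * pairing (g a) (fun z => ainv z y).
  have HSx := gs_lincomb gH (c x) HZ; have HSy := gs_lincomb gH (c y) HZ.
  have i1 := gs_intM gH (Hxi x) (Huc y).
  have i2 := gs_intM gH (Hxi x) HSy.
  have i3 := gs_intM gH (Huc x) (Huc y).
  have i4 := gs_intM gH (Huc y) HSx.
  (* Only [xi y] is expanded, so its regression part drops out by orthogonality to [xi x]; expanding
     [xi x] afterwards leaves a single sum. *)
  transitivity (\int[P]_w (xi x w * uc y w - xi x w * \sum_(a < N) c y a * Z a w)).
    by apply: eq_Rintegral => w _; rewrite {2}/xi; ring.
  rewrite RintegralB// (gs_mul_lincomb gH)//.
  rewrite [X in _ - X]big1 ?subr0; last by move=> k _; rewrite xiZ mulr0.
  transitivity (\int[P]_w (uc x w * uc y w - uc y w * \sum_(a < N) c x a * Z a w)).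
    by apply: eq_Rintegral => w _; rewrite /xi; ring.
  rewrite RintegralB// (gs_mul_lincomb gH)// fine_covariance; congr (_ - _).
  apply: eq_bigr => a _; rewrite covuZ; congr (_ * pairing _ _).
  (* The pairing arises in the second argument of [ainv], the claim has it in the first; symmetry of
     the covariance exchanges them. *)
  apply/funext => z; apply: EFin_inj; rewrite -!u_cov; exact: covarianceC.
pose phi z (V : 'cV[R]_N) := \int[P]_w u z w + \sum_(a < N) c z a * (V a 0 - \int[P]_w U a w).
have phiU z w : phi z (\col_a U a w) = \int[P]_w u z w + \sum_(a < N) c z a * Z a w.
  by rewrite /phi; congr (_ + _); apply: eq_bigr => a _; rewrite mxE.
have uE z w : u z w = phi z (\col_a U a w) + xi z w.
  by rewrite phiU /xi /uc /centered; ring.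
have cphi z : continuous (phi z) by exact: continuous_col_affine.
have icst (r : R) : P.-integrable setT (EFin \o cst r).
  exact: finite_measure_integrable_cst.
have iphi z : P.-integrable setT (EFin \o (fun w => phi z (\col_a U a w))).
  have := integrableB measurableT (iu z) (gs_int gH (Hxi z)).
  by apply: eq_integrable => // w _ /=; rewrite uE -EFinB addrK.
have cm z : is_cond_mean U (u z) (phi z).
  apply: is_cond_meanP => // A sA.
  (* Taken with B = [setT], this supplies the measurability of [A] in [T]. *)
  have [mA _] := gs_independent gH HZ (Hxi z) (xiZ z) measurableT (sZ A sA).
  split => //; rewrite -[RHS](gs_uncorrelated_sigma gH HZ (Hxi z) (xiZ z) (sZ A sA)).
  by apply: eq_Rintegral => w _; rewrite uE addrC addKr.
pose phi2 V := phi x V * phi y V + ka.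
have iSS : P.-integrable setT (EFin \o (fun w => phi x (\col_a U a w) * phi y (\col_a U a w))).
  have HSx := gs_lincomb gH (c x) HZ; have HSy := gs_lincomb gH (c y) HZ.
  have j0 := icst (\int[P]_w u x w * \int[P]_w u y w).
  have j1 := integrableZl measurableT (\int[P]_w u x w) (gs_int gH HSy).
  have j2 := integrableZl measurableT (\int[P]_w u y w) (gs_int gH HSx).
  have j3 := gs_intM gH HSx HSy.
  have := integrableD measurableT (integrableD measurableT j0 j1) (integrableD measurableT j2 j3).
  by apply: eq_integrable => // w _; rewrite /= -!EFinM -!EFinD !phiU; congr EFin; ring.
have iphixi z t : P.-integrable setT (EFin \o (fun w => phi z (\col_a U a w) * xi t w)).
  have HS := gs_lincomb gH (c z) HZ.
  have j1 := integrableZl measurableT (\int[P]_w u z w) (gs_int gH (Hxi t)).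
  have j2 := gs_intM gH (Hxi t) HS.
  have := integrableD measurableT j1 j2.
  by apply: eq_integrable => // w _; rewrite /= -EFinM -EFinD !phiU; congr EFin; ring.
have phixi z t A : measurable A -> g_sigma_preimage U A ->
    \int[P]_(w in A) (phi z (\col_a U a w) * xi t w) = 0.
  move=> mA sA; have HS := gs_lincomb gH (c z) HZ.
  have S (f : T -> R) := fun i => @integrableS _ _ _ P _ A (EFin \o f) measurableT mA (@subsetT _ _) i.
  have j0 := S _ (gs_int gH (Hxi t)).
  have j1 := S _ (integrableZl measurableT (\int[P]_w u z w) (gs_int gH (Hxi t))).
  have j2 := S _ (gs_intM gH (Hxi t) HS).
  transitivity (\int[P]_(w in A) (\int[P]_w u z w * xi t w + xi t w * \sum_(a < N) c z a * Z a w)).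
    by apply: eq_Rintegral => w _; rewrite phiU; ring.
  rewrite RintegralD// RintegralZl//.
  rewrite (gs_uncorrelated_sigma gH HZ (Hxi t) (xiZ t) (sZ A sA)) mulr0 add0r.
  exact: (gs_uncorrelated_mul_sigma gH HZ (c z) (Hxi t) (xiZ t) (sZ A sA)).
have ixx := gs_intM gH (Hxi x) (Hxi y).
have cm2 : is_cond_mean U (fun w => u x w * u y w) phi2.
  apply: is_cond_meanP => //.
  - apply: continuous_colD; last exact: cst_continuous.
    by apply: continuous_colM; exact: cphi.
  - have := integrableD measurableT (integrableD measurableT iSS (iphixi x y))
      (integrableD measurableT (iphixi y x) ixx).
    by apply: eq_integrable => // w _; rewrite /= -!EFinD !uE; congr EFin; ring.
  - exact: (integrableD measurableT iSS (icst ka)).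
  move=> A sA.
  have [mA _] := gs_independent gH HZ (Hxi x) (xiZ x) measurableT (sZ A sA).
  split => //.
  have S (f : T -> R) := fun i => @integrableS _ _ _ P _ A (EFin \o f) measurableT mA (@subsetT _ _) i.
  have j1 := S _ (iphixi x y); have j2 := S _ (iphixi y x).
  have j3 := S _ (integrableB measurableT ixx (icst ka)).
  have j12 := integrableD mA j1 j2.
  (* Expanding u(x)u(y) cancels the product of the conditional means. Two cross terms remain, null
     over [A], besides the centred product of residuals. *)
  transitivity (\int[P]_(w in A) (phi x (\col_a U a w) * xi y w + phi y (\col_a U a w) * xi x w
    + (xi x w * xi y w - ka))).
    by apply: eq_Rintegral => w _; rewrite !uE /phi2; ring.
  rewrite RintegralD// RintegralD// !phixi// !add0r.
  exact: (gs_mul_sigma gH HZ (Hxi x) (Hxi y) (xiZ x) (xiZ y) (sZ A sA)).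
(* [cond_mean] picks an unspecified version through [xget]; uniqueness identifies it with the
   explicit one. *)
have cmE O f V : is_cond_mean U O f -> cond_mean U O V = f V.
  move=> cf; rewrite /cond_mean; case: xgetP => [f' -> cf'|/(_ f)//].
  by rewrite (is_cond_mean_unique supp cf' cf).
split.
- by exists (phi x); split => // f; exact: is_cond_mean_unique supp (cm x).
- by exists (phi y); split => // f; exact: is_cond_mean_unique supp (cm y).
- by exists phi2; split => // f; exact: is_cond_mean_unique supp cm2.
- move=> V; rewrite /cond_cov (cmE _ _ _ (cm x)) (cmE _ _ _ (cm y)) (cmE _ _ _ cm2).
  by rewrite /phi2 addrC addKr kaE.
Qed.
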